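(* Let $z\in\mathbb{C}\setminus\{0\}$ be fixed. The Lerch-type Dirichlet series $\varphi(z,s,0)=\sum_{n=1}^{\infty} z^n a_n^{-s}$, which as a function of $s$ is holomorphic for $\Re(s)>\frac{\log |z|}{\log\alpha_1}$, has an analytic continuation to a meromorphic function of the whole $s$-plane whose poles are all simple, and they are the points $$s^{(z)}_{n,k_1,\dots,k_{r-1}}=\frac{\log |z|}{\log\alpha_1}+i\,\frac{2\pi\xi}{\log\alpha_1}+s_{n,k_1,\dots,k_{r-1}},\qquad n,k_i\in\mathbb{Z},\quad k_1\ge\dots\ge k_{r-1}\ge 0 .$$
   Context: Setting: $\{a_n\}_{n\ge 1}$ is a linear recurrence sequence over $\mathbb{Z}$, i.e. a sequence of integers for which there is a monic $Q\in\mathbb{Z}[X]$ with $Q(\nabla)a_n=0$ for all $n$, where $\nabla a_n=a_{n+1}$. Its minimal polynomial $P\in\mathbb{Z}[X]$ (the monic polynomial of least degree with $P(\nabla)$ annihilating $\{a_n\}$) is assumed irreducible over $\mathbb{Q}$, of degree $r$, with (simple) roots $\alpha_1,\dots,\alpha_r\in\mathbb{C}$, and $\alpha_1$ is a dominant root: $\alpha_1$ is real, $\alpha_1>1$ and $\alpha_1>|\alpha_i|$ for $i=2,\dots,r$. The sequence $\{a_n\}$ is assumed to be a strictly increasing sequence of positive integers. Powers $a_n^{-s}$ are defined through the real logarithm. Notation: $\xi=\frac{1}{2\pi}\arg(z)$, so $z=|z|e^{2\pi i\xi}$. For integers $n$ and $k_1\ge\dots\ge k_{r-1}\ge 0$,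 $$s_{n,k_1,\dots,k_{r-1}}=\frac{\log\left|\alpha_1^{-k_1}\alpha_2^{k_1-k_2}\cdots\alpha_{r-1}^{k_{r-2}-k_{r-1}}\alpha_r^{k_{r-1}}\right|}{\log\alpha_1}+i\,\frac{\arg\left(\alpha_2^{k_1-k_2}\cdots\alpha_{r-1}^{k_{r-2}-k_{r-1}}\alpha_r^{k_{r-1}}\right)+2\pi n}{\log\alpha_1}.$$ With the convention $k_r=0$ the product is $\alpha_1^{-k_1}\prod_{i=2}^r\alpha_i^{k_{i-1}-k_i}$.
   Formalization: Not every listed point is a pole (a_n=F_{n+1}, z=φ^4, s=0 is regular): proved instead that all poles are simple and among the points, and a point is a pole exactly when an explicit finite sum of binomial/Binet coefficients over the tuples giving that point is nonzero. *)

(* Defs.v *)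
From HB Require Import structures.
From mathcomp Require Import all_boot all_order all_algebra.
From mathcomp Require Import all_classical all_reals all_analysis.
From mathcomp Require Export complex.

Set Implicit Arguments.
Unset Strict Implicit.
Unset Printing Implicit Defensive.

Import Order.TTheory GRing.Theory Num.Theory.
Import numFieldNormedType.Exports.

Local Open Scope ring_scope.
Local Open Scope complex_scope.
Local Open Scope classical_set_scope.

(* Sequences [a : nat -> int] are indexed from 1: the value [a 0] is never
   used. *)

(* [Q(nabla) a = 0], where [nabla] is the shift. *)
Definition annihilates (Q : {poly int}) (a : nat -> int) :=
  forall n : nat, (0 < n)%N -> \sum_(i < size Q) Q`_i * a (n + i)%N = 0.

Definition minimal_annihilator (P : {poly int}) (a : nat -> int) :=
  [/\ P \is monic, annihilates P a &
      forall Q : {poly int}, Q \is monic -> annihilates Q a ->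
        (size P <= size Q)%N].

Section ComplexAnalysis.
Variable R : realType.
Implicit Types (s w : R[i]) (f : R[i]^o -> R[i]^o).

(* The modulus as an element of [R]; the library's [`|w|] lives in [R[i]]. *)
Definition cmod w : R := complex.Re `|w|.

(* Principal argument, in ]-pi, pi]. *)
Definition carg w : R :=
  if 0 <= complex.Im w then acos (complex.Re w / cmod w)
  else - acos (complex.Re w / cmod w).

Definition cexp w : R[i] :=
  (expR (complex.Re w) * cos (complex.Im w)) +i*
  (expR (complex.Re w) * sin (complex.Im w)).

(* [R[i]^o] is the normed space [R[i]] over the field [R[i]], so that
   [derivable f t 1] is complex differentiability. *)
Definition holomorphic_at f s :=
  \forall t \near (s : R[i]^o), derivable f t 1.

Definition pole_of_order f s (m : nat) :=
  (0 < m)%N /\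
  exists g : R[i]^o -> R[i]^o,
    [/\ holomorphic_at g s, g s != 0 &
        \forall t \near (s : R[i]^o)^', f t = g t / (t - s) ^+ m].

Definition is_pole f s := exists m : nat, pole_of_order f s m.

(* The value of [f] at a pole is irrelevant. *)
Definition meromorphic f := forall s, holomorphic_at f s \/ is_pole f s.

Definition cbinom w (k : nat) : R[i] :=
  (\prod_(i < k) (w - i%:R)) / (k`!)%:R.

End ComplexAnalysis.

Section LerchSeries.
Variables (R : realType).

(* [z^n a_n^{-s}] *)
Definition lerch_term (a : nat -> int) (z s : R[i]) (n : nat) : R[i]^o :=
  z ^+ n * cexp (- s * (ln ((a n)%:~R : R))%:C).

Definition lerch_partial_sum (a : nat -> int) (z s : R[i]) (N : nat) : R[i]^o :=
  \sum_(1 <= n < N) lerch_term a z s n.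

Definition lerch_series (a : nat -> int) (z : R[i]) : R[i]^o -> R[i]^o :=
  fun s => limn (lerch_partial_sum a z s).

(* The roots alpha_1, ..., alpha_r with r = d + 1 are [alpha 0, ..., alpha d],
   and a tuple (k_1, ..., k_{r-1}) is [k : d.-tuple nat], zero-based as well. *)
Variables (d : nat) (alpha : 'I_d.+1 -> R[i]).

(* [kidx k j] is k_{j+1}; reading out of bounds gives the convention k_r = 0. *)
Definition kidx (k : d.-tuple nat) (j : nat) : nat := nth 0%N k j.

(* alpha_2^{k_1-k_2} ... alpha_{r-1}^{k_{r-2}-k_{r-1}} alpha_r^{k_{r-1}} *)
Definition root_prod (k : d.-tuple nat) : R[i] :=
  \prod_(i < d) alpha (lift ord0 i) ^+ (kidx k i - kidx k i.+1).

Definition log_dominant : R := ln (complex.Re (alpha ord0)).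

(* s_{n,k_1,...,k_{r-1}} *)
Definition base_point (n : int) (k : d.-tuple nat) : R[i] :=
  (ln (cmod (alpha ord0 ^- (kidx k 0) * root_prod k)) / log_dominant) +i*
  ((carg (root_prod k) + 2 * pi * n%:~R) / log_dominant).

Definition abscissa (z : R[i]) : R := ln (cmod z) / log_dominant.

(* s^{(z)}_{n,k_1,...,k_{r-1}} *)
Definition lerch_point (z : R[i]) (n : int) (k : d.-tuple nat) : R[i] :=
  let xi := carg z / (2 * pi) in
  (abscissa z +i* (2 * pi * xi / log_dominant)) + base_point n k.

Definition indices_at (z s : R[i]) : set (d.-tuple nat) :=
  [set k : d.-tuple nat | sorted geq k /\ exists n : int, s = lerch_point z n k].

(* With a_n = sum_i lambda_i alpha_i^n, expand
     a_n^{-s} = (lambda_1 alpha_1^n)^{-s}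
                (1 + sum_{i>=2} (lambda_i/lambda_1) (alpha_i/alpha_1)^n)^{-s}
   by the multinomial series and sum over n: the tuple k contributes, at each
   of its points, a polar part lambda_1^{-s}/log(alpha_1) times the k-th
   summand below.  Only finitely many tuples share a given point (the moduli
   |alpha_i/alpha_1| are < 1), so the finitely supported sum is the true sum;
   up to a nonzero factor it is the residue of the continuation.  It can vanish
   at some points of the family: for a_n = F_{n+1} (Fibonacci), with golden
   ratio phi and z = phi^4, the point s = 0 arises from k_1 = 2 only, where
   binomial(-s, 2) = 0. *)
Definition polar_coef (lambda : 'I_d.+1 -> R[i]) (z s : R[i]) : R[i] :=
  \sum_(k \in indices_at z s)
    (cbinom (- s) (kidx k 0) *
     \prod_(j < d) ('C(kidx k j, kidx k j.+1))%:R *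
     \prod_(i < d) (lambda (lift ord0 i) / lambda ord0)
                     ^+ (kidx k i - kidx k i.+1)).

End LerchSeries.

(* Main.v *)
Require Import Defs.
From mathcomp Require Import all_boot all_order all_algebra.
From mathcomp Require Import all_classical all_reals all_analysis.
From mathcomp Require Import ring lra zify.

Import Order.TTheory GRing.Theory Num.Theory.
Import numFieldNormedType.Exports.
Local Open Scope ring_scope.
Local Open Scope complex_scope.
Local Open Scope classical_set_scope.

Set Implicit Arguments.
Unset Strict Implicit.
Unset Printing Implicit Defensive.

(** Write [a_n = lambda_1 alpha_1 ^ n * (1 + eps_n)].  The closed form of the recurrence gives
[eps_n = \sum_(i >= 2) (lambda_i / lambda_1) (alpha_i / alpha_1) ^ n], which is real, exceeds [-1]
and is [O(rho ^ n)] for some [rho < 1] ([perturbation]).  With [l = ln alpha_1] and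
[w s = z e ^ (- l s)] the series is [lambda_1 ^ (- s) \sum_n w s ^ n (1 + eps_n) ^ (- s)].

Cut the binomial expansion of [(1 + eps_n) ^ (- s)] at order [K].  The remainder is
[O(rho ^ (n K))], so the series of remainders converges and is holomorphic on the half plane
[|w s| rho ^ K < 1], and these half planes exhaust the complex plane as [K] grows.  By the
multinomial theorem each term [binomial (- s) k * eps_n ^ k] that was cut off is a finite
combination of powers [beta ^ n], where [beta] is a product of [k] ratios [alpha_i / alpha_1], and
[\sum_n (w s * beta) ^ n = w s * beta / (1 - w s * beta)] is meromorphic in the whole plane, with
poles where [w s * beta = 1], that is at the points of the theorem ([lerch_pointP]).  Replacing [K]
by [K + 1] moves finitely many convergent geometric series from one part of the formula to the
other ([partial_continuation_step]), so that the formulas for different [K] agree wherever both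
make sense; the continuation is obtained by glueing them, without an identity theorem.

The holomorphy of the series of remainders does not go through Cauchy's integral formula.
Each summand [f] satisfies [f (s + h) = f s + h f' s + O(h ^ 2)] with a constant that is geometric
in [n], and such expansions can be added up ([quad_approx_csum]).  For the binomial remainder
the constants come from interpolation ([binom_remE]): in the variable [- s], the truncated binomial
series is a polynomial of degree less than [K] which agrees with [(1 + eps) ^ (- s)] at
[0, ..., K - 1].  Comparing it there with the Taylor polynomial of [e ^ (- s ln (1 + eps))] writes
the binomial remainder as a combination of remainders of the exponential series, which the mean
value inequality bounds ([exp_tail_le], [exp_tail_quad]).

Near a point [s0] all singular summands have the common factor [1 / (1 - e ^ (- l (t - s0)))], so
the continuation is [G t / (t - s0)] with [G] holomorphic and [G s0] a nonzero multiple of the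
polar coefficient at [s0] ([continuation_local]).  Hence every pole is simple.  The sum of the
coefficients of the singular summands is a polynomial in [t] whose value at [s0] is the polar
coefficient; if that vanishes, the polynomial is divisible by [t - s0] and the singularity is
removable ([fill_in]).

All this needs [lambda_1 <> 0].  Up to a nonzero factor, [lambda_1] is the value at [alpha_1] of a
polynomial with integer coefficients, of degree less than that of [P] and with leading coefficient
[a_1]; since [P] is irreducible, that value is not zero ([shift_functional_dominant_neq0]). *)

(** * Modulus and topology of the complex field *)

Section Modulus.
Variable R : realType.
Implicit Types (u v w s t h : R[i]) (x y : R) (f g : R[i]^o -> R[i]^o).

Lemma cmodE w : cmod w = Num.sqrt (complex.Re w ^+ 2 + complex.Im w ^+ 2).
Proof. by rewrite /cmod normc_def. Qed.

Lemma norm_cmod w : `|w| = (cmod w)%:C.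
Proof. by rewrite cmodE normc_def. Qed.

Lemma cmod_ge0 w : 0 <= cmod w.
Proof. by rewrite cmodE sqrtr_ge0. Qed.

Lemma cmodM u v : cmod (u * v) = cmod u * cmod v.
Proof. by apply: complexI; rewrite -norm_cmod normrM !norm_cmod -rmorphM. Qed.

Lemma cmod0 : cmod (0 : R[i]) = 0.
Proof. by rewrite /cmod normr0. Qed.

Lemma cmod1 : cmod (1 : R[i]) = 1.
Proof. by rewrite /cmod normr1. Qed.

Lemma cmod_eq0 w : (cmod w == 0) = (w == 0).
Proof. by rewrite -(inj_eq (@complexI R)) -norm_cmod normr_eq0. Qed.

Lemma cmod_gt0 w : (0 < cmod w) = (w != 0).
Proof. by rewrite lt_def cmod_ge0 cmod_eq0 andbT. Qed.

Lemma cmodN w : cmod (- w) = cmod w.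
Proof. by rewrite /cmod normrN. Qed.

Lemma cmodC u v : cmod (u - v) = cmod (v - u).
Proof. by rewrite -cmodN opprB. Qed.

Lemma cmodD u v : cmod (u + v) <= cmod u + cmod v.
Proof. by rewrite -lecR rmorphD /= -!norm_cmod ler_normD. Qed.

Lemma cmodV w : cmod w^-1 = (cmod w)^-1.
Proof.
have [->|w0] := eqVneq w 0; first by rewrite invr0 cmod0 invr0.
have c0 : cmod w != 0 by rewrite cmod_eq0.
by apply: (mulfI c0); rewrite -cmodM !divff // cmod1.
Qed.

Lemma cmodX w n : cmod (w ^+ n) = cmod w ^+ n.
Proof. by elim: n => [|n IH]; rewrite ?expr0 ?cmod1// !exprS cmodM IH. Qed.

Lemma cmod_prod I (r : seq I) (P : pred I) (F : I -> R[i]) :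
  cmod (\prod_(i <- r | P i) F i) = \prod_(i <- r | P i) cmod (F i).
Proof. exact: (big_morph _ cmodM cmod1). Qed.

Lemma cmod_sum I (r : seq I) (P : pred I) (F : I -> R[i]) :
  cmod (\sum_(i <- r | P i) F i) <= \sum_(i <- r | P i) cmod (F i).
Proof.
elim/big_ind2 : _ => [||//]; first by rewrite cmod0.
by move=> u x v y ux vy; rewrite (le_trans (cmodD _ _)) ?lerD.
Qed.

Lemma cmod_real x : cmod x%:C = `|x|.
Proof. by rewrite cmodE /= expr0n addr0 sqrtr_sqr. Qed.

Lemma Re_le_cmod w : `|complex.Re w| <= cmod w.
Proof. by rewrite -lecR -norm_cmod normc_ge_Re. Qed.

Lemma Im_le_cmod w : `|complex.Im w| <= cmod w.
Proof.
rewrite cmodE -sqrtr_sqr ler_wsqrtr // lerDr sqr_ge0 //.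
Qed.

Lemma cmod_le_ReIm w : cmod w <= `|complex.Re w| + `|complex.Im w|.
Proof.
case: w => a b; have -> : a +i* b = a%:C + (0 +i* b) by simpc.
apply: le_trans (cmodD _ _) _; rewrite cmod_real [cmod (0 +i* b)]cmodE /= expr0n add0r.
by rewrite sqrtr_sqr addr0 add0r.
Qed.

Lemma ReM_real u x : complex.Re (u * x%:C) = complex.Re u * x.
Proof. by case: u => a b; simpc. Qed.

Lemma ReD u v : complex.Re (u + v) = complex.Re u + complex.Re v.
Proof. by case: u; case: v. Qed.

Lemma ImD u v : complex.Im (u + v) = complex.Im u + complex.Im v.
Proof. by case: u; case: v. Qed.

Lemma ReN u : complex.Re (- u) = - complex.Re u.
Proof. by case: u. Qed.

Lemma ImN u : complex.Im (- u) = - complex.Im u.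
Proof. by case: u. Qed.

Lemma complex_ext u v :
  complex.Re u = complex.Re v -> complex.Im u = complex.Im v -> u = v.
Proof. by case: u => a b; case: v => a' b' /= -> ->. Qed.

(** Positive elements of [R[i]] are the positive reals, so neighbourhoods are governed by real
radii; estimates can then be carried out in [R]. *)
Lemma nearE_cmod (s : R[i]^o) (P : set R[i]^o) :
  (\forall t \near s, P t) <->
  exists2 e : R, 0 < e & forall t, cmod (t - s) < e -> P t.
Proof.
split.
  move/nbhs_ballP => [[e e'] /= e0 Pe].
  have [e00 ee] : e' = 0 /\ 0 < e.
    by move: e0; rewrite ltcE /= => /andP[/eqP -> ->].
  exists e => // t ts; apply: Pe; rewrite -ball_normE /= distrC norm_cmod.
  by rewrite e00 ltcE /= eqxx.
move=> [e e0 Pe]; apply/nbhs_ballP; exists e%:C => /=; first by rewrite ltcR.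
move=> t; rewrite -ball_normE /= distrC norm_cmod ltcR; exact: Pe.
Qed.

Lemma dnearE_cmod (s : R[i]^o) (P : set R[i]^o) :
  (\forall t \near s^', P t) <->
  exists2 e : R, 0 < e & forall t, cmod (t - s) < e -> t != s -> P t.
Proof.
rewrite near_withinE; split=> [/nearE_cmod//|H]; exact/nearE_cmod.
Qed.

Lemma cvg_cmod T (F : set_system T) (FF : Filter F) (f : T -> R[i]^o)
    (l : R[i]^o) :
  (f @ F --> l) <-> (forall e : R, 0 < e -> \forall n \near F, cmod (f n - l) < e).
Proof.
split => [/cvgrPdist_lt H e e0|H]; last (apply/cvgrPdist_lt=> e e0).
- have : 0 < e%:C by rewrite ltcR.
  by move/(H _); apply: filterS => n; rewrite distrC norm_cmod ltcR.
- case: e e0 => e e' /=; rewrite ltcE /= => /andP[/eqP -> e0].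
move: (H _ e0); apply: filterS => n; rewrite distrC norm_cmod.
by rewrite ltcE /= eqxx.
Qed.

Lemma derivable_continuous_at f s : derivable f s 1 -> {for (s : R[i]^o), continuous f}.
Proof. by move=> /derivable1_diffP/differentiable_continuous. Qed.

(** Differentiability is only ever established through a quadratic error bound, which, unlike
a limit of difference quotients, can be summed over the terms of a series. *)
Lemma derivable_quad f s d (M rho : R) : 0 < rho ->
  (forall h, cmod h <= rho -> cmod (f (s + h) - f s - h * d) <= M * cmod h ^+ 2) ->
  derivable f s 1.
Proof.
move=> rho0 H; apply/cvg_ex; exists (d : R[i]^o); apply/cvg_cmod => e e0.
apply/dnearE_cmod.
have M0 : 0 < `|M| + 1 by rewrite ltr_wpDl.
exists (Num.min rho (e / (`|M| + 1))); first by rewrite lt_min rho0 divr_gt0.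
move=> h; rewrite subr0 lt_min => /andP[h1 h2] h0.
have ch0 : 0 < cmod h by rewrite cmod_gt0.
rewrite -(ltr_pM2r ch0) -cmodM mulrBl /GRing.scale/= mulrC mulrA divff //.
rewrite mul1r [h * 1]mulr1 (addrC h) (mulrC d).
apply: le_lt_trans (H h (ltW h1)) _.
rewrite expr2 mulrA ltr_pM2r //.
apply: le_lt_trans (_ : (`|M| + 1) * cmod h < _); last by rewrite mulrC -ltr_pdivlMr.
by rewrite ler_wpM2r ?(ltW ch0) // (le_trans (ler_norm _)) // lerDl.
Qed.

Lemma holomorphic_derivable f s : holomorphic_at f s -> derivable f s 1.
Proof. by move/nbhs_singleton. Qed.

End Modulus.

(** * The complex exponential and its Taylor remainders *)

Section ComplexExponential.
Variable R : realType.
Implicit Types (u v w s : R[i]) (x y t : R).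

Lemma cexpD u v : cexp (u + v) = cexp u * cexp v.
Proof.
rewrite /cexp ReD ImD expRD cosD sinD; apply: complex_ext => /=; ring.
Qed.

Lemma cexp_real x : cexp x%:C = (expR x)%:C :> R[i].
Proof. by rewrite /cexp /= cos0 sin0 mulr1 mulr0. Qed.

Lemma cexp0 : cexp 0 = 1 :> R[i].
Proof. by have := cexp_real 0; rewrite expR0. Qed.

Lemma cmod_cexp u : cmod (cexp u) = expR (complex.Re u).
Proof.
rewrite cmodE /= !exprMn -mulrDr cos2Dsin2 mulr1 sqrtr_sqr ger0_norm ?expR_ge0 //.
Qed.

Lemma cexp_neq0 u : cexp u != 0.
Proof. by rewrite -cmod_eq0 cmod_cexp gt_eqF // expR_gt0. Qed.

Lemma cexpN u : cexp (- u) = (cexp u)^-1.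
Proof.
by apply: (mulfI (cexp_neq0 u)); rewrite -cexpD subrr cexp0 divff ?cexp_neq0.
Qed.

Lemma cexpM_nat u n : cexp (n%:R * u) = cexp u ^+ n.
Proof.
elim: n => [|n IH]; first by rewrite mul0r cexp0.
by rewrite exprS -IH -cexpD -natr1 mulrDl mul1r addrC.
Qed.

(** Derivative of a complex-valued function of a real variable: the real mean value theorem is
available for the two components. *)
Definition cderive (f : R -> R[i]) t (d : R[i]) :=
  is_derive t 1 (fun x => complex.Re (f x)) (complex.Re d) /\
  is_derive t 1 (fun x => complex.Im (f x)) (complex.Im d).

Lemma cderive_cst w t : cderive (fun=> w) t 0.
Proof. by split; apply: is_derive_cst. Qed.

Lemma cderiveD f g t a b : cderive f t a -> cderive g t b ->
  cderive (fun x => f x + g x) t (a + b).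
Proof.
move=> [f1 f2] [g1 g2]; split; rewrite ?ReD ?ImD.
- by under eq_fun do rewrite ReD; apply: is_deriveD.
- by under eq_fun do rewrite ImD; apply: is_deriveD.
Qed.

Lemma ReM u v : complex.Re (u * v) =
  complex.Re u * complex.Re v - complex.Im u * complex.Im v.
Proof. by case: u; case: v. Qed.

Lemma ImM u v : complex.Im (u * v) =
  complex.Re u * complex.Im v + complex.Im u * complex.Re v.
Proof. by case: u; case: v. Qed.

Lemma cderiveM f g t a b : cderive f t a -> cderive g t b ->
  cderive (fun x => f x * g x) t (a * g t + f t * b).
Proof.
move=> [f1 f2] [g1 g2]; split; rewrite ?ReD ?ImD ?ReM ?ImM.
- under eq_fun do rewrite ReM.
  apply: (is_derive_eq (is_deriveB (is_deriveM f1 g1) (is_deriveM f2 g2))).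
  by rewrite /GRing.scale /=; ring.
- under eq_fun do rewrite ImM.
  apply: (is_derive_eq (is_deriveD (is_deriveM f1 g2) (is_deriveM f2 g1))).
  by rewrite /GRing.scale /=; ring.
Qed.

Lemma cderive_line u v t : cderive (fun x => u + x%:C * v) t v.
Proof.
split; [under eq_fun do rewrite ReD ReM /= mul0r subr0 |
        under eq_fun do rewrite ImD ImM /= mul0r addr0];
  apply: is_derive_eq; rewrite /GRing.scale /=; ring.
Qed.

Lemma cderive_cexp u v t :
  cderive (fun x => cexp (u + x%:C * v)) t (v * cexp (u + t%:C * v)).
Proof.
have e1 x : complex.Re (u + x%:C * v) = complex.Re u + x * complex.Re v.
  by rewrite ReD ReM /= mul0r subr0.
have e2 x : complex.Im (u + x%:C * v) = complex.Im u + x * complex.Im v.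
  by rewrite ImD ImM /= mul0r addr0.
split; rewrite ?ReM ?ImM /cexp /= e1 e2; under eq_fun do rewrite e1 e2;
  apply: is_derive_eq; rewrite /GRing.scale /=; ring.
Qed.

Lemma cderiveX f t a n : cderive f t a ->
  cderive (fun x => f x ^+ n) t (n%:R * f t ^+ n.-1 * a).
Proof.
move=> fa; elim: n => [|n IH].
  by rewrite !mul0r; exact: cderive_cst.
rewrite (_ : (fun x => _) = (fun x => f x ^+ n * f x)); last first.
  by apply/funext => x; rewrite exprSr.
rewrite (_ : _ * a = n%:R * f t ^+ n.-1 * a * f t + f t ^+ n * a).
  exact: cderiveM.
case: n {IH} => [|n] /=; first by rewrite !mul0r add0r mul1r.
by rewrite -[in LHS]natr1 exprS; ring.
Qed.

(** Mean value inequality.  The mean value theorem applies to the real and imaginary parts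
separately, which costs the factor 2. *)
Lemma cderive_le f d (M : R) :
  (forall t, cderive f t (d t)) -> (forall t, 0 <= t <= 1 -> cmod (d t) <= M) ->
  cmod (f 1 - f 0) <= 2 * M.
Proof.
move=> fd dM.
have bnd (p : R[i] -> R) : (forall w, `|p w| <= cmod w) ->
    (forall t, is_derive t 1 (fun x => p (f x)) (p (d t))) ->
    `|p (f 1) - p (f 0)| <= M.
  move=> pw H.
  have pc : {within `[0, 1], continuous (fun x => p (f x))}.
    apply: continuous_subspaceT => x.
    by apply/differentiable_continuous/derivable1_diffP; have [] := H x.
  have [c c01 ->] := MVT_segment ler01 (fun x _ => H x) pc.
  rewrite subr0 mulr1; apply: le_trans (pw _) _; apply: dM.
  by move: c01; rewrite in_itv.
apply: le_trans (cmod_le_ReIm _) _; rewrite ReD ImD ReN ImN mulr_natl mulr2n.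
apply: lerD; apply: bnd => //; do ?[exact: Re_le_cmod|exact: Im_le_cmod].
  by move=> t; have [] := fd t.
by move=> t; have [] := fd t.
Qed.

Definition exp_tail K u : R[i] := cexp u - \sum_(j < K) u ^+ j / j`!%:R.

(** Differentiating lowers the order of the remainder by one; the order 0 remainder is the
exponential itself, so that the truncated predecessor [K.-1] is correct for [K = 0] as well. *)
Lemma cderive_exp_tail K u v t :
  cderive (fun x => exp_tail K (u + x%:C * v)) t
          (v * exp_tail K.-1 (u + t%:C * v)).
Proof.
elim: K => [|K IH] /=.
  rewrite /exp_tail big_ord0 subr0; under eq_fun do rewrite big_ord0 subr0.
  exact: cderive_cexp.
rewrite (_ : (fun x => _) = (fun x => exp_tail K (u + x%:C * v) +
    (u + x%:C * v) ^+ K * - (K`!%:R)^-1)); last first.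
  by apply/funext => x; rewrite /exp_tail big_ord_recr /= opprD addrA mulrN.
have := cderiveD IH (cderiveM (cderiveX K (cderive_line u v t)) (cderive_cst (- (K`!%:R)^-1) t)).
congr cderive; rewrite mulr0 addr0.
case: K {IH} => [|K] /=; first by rewrite !mul0r addr0.
rewrite {1}/exp_tail [in RHS]/exp_tail big_ord_recr /= factS natrM.
have k1 : K.+1%:R != 0 :> R[i] by rewrite pnatr_eq0.
have k2 : K`!%:R != 0 :> R[i] by rewrite pnatr_eq0 -lt0n fact_gt0.
by field; rewrite k2 addrC natr1.
Qed.

Lemma exp_tail0 K : exp_tail K.+1 0 = 0.
Proof.
rewrite /exp_tail big_ord_recl /= expr0 fact0 divr1 big1 ?addr0.
  by rewrite cexp0 subrr.
by move=> i _; rewrite expr0n /= mul0r.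
Qed.

(** Induction on the order, by the mean value inequality on the segment from 0 to [u]. *)
Lemma exp_tail_le K u : cmod (exp_tail K u) <= (2 * cmod u) ^+ K * expR (cmod u).
Proof.
elim: K u => [|K IH] u.
  rewrite /exp_tail big_ord0 subr0 expr0 mul1r cmod_cexp ler_expR.
  exact: le_trans (ler_norm _) (Re_le_cmod _).
have := @cderive_le (fun x => exp_tail K.+1 (0 + x%:C * u)) _
  (cmod u * ((2 * cmod u) ^+ K * expR (cmod u))) (cderive_exp_tail K.+1 0 u).
rewrite !add0r mul1r mul0r exp_tail0 subr0 exprS !mulrA; apply => t /andP[t0 t1].
rewrite add0r cmodM -mulrA ler_wpM2l ?cmod_ge0 //.
have tu : cmod (t%:C * u) <= cmod u.
  by rewrite cmodM cmod_real ger0_norm // ler_piMl ?cmod_ge0.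
apply: le_trans (IH _) _; apply: ler_pM; rewrite ?exprn_ge0 ?expR_ge0 ?ler_expR//.
  by rewrite mulr_ge0 ?cmod_ge0.
by rewrite lerXn2r ?nnegrE ?mulr_ge0 ?cmod_ge0 // ler_wpM2l.
Qed.

Lemma exp_tail_le_bound K u (B : R) : cmod u <= B ->
  cmod (exp_tail K u) <= (2 * B) ^+ K * expR B.
Proof.
move=> uB; have B0 := le_trans (cmod_ge0 u) uB.
apply: le_trans (exp_tail_le _ _) _; apply: ler_pM; rewrite ?expR_ge0 ?ler_expR//.
  by rewrite exprn_ge0 // mulr_ge0 // cmod_ge0.
by rewrite lerXn2r ?nnegrE ?mulr_ge0 ?cmod_ge0 // ler_wpM2l.
Qed.

(** Second-order expansion of the remainder itself; two applications of the mean value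
inequality.  What matters later is that the bound still has order [K] when [u] and [v] are both
proportional to a small parameter. *)
Lemma exp_tail_quad K u v (B : R) : cmod u + cmod v <= B ->
  cmod (exp_tail K (u + v) - exp_tail K u - v * exp_tail K.-1 u) <=
    4 * cmod v ^+ 2 * ((2 * B) ^+ K.-2 * expR B).
Proof.
move=> uvB.
have line t : 0 <= t <= 1 -> cmod (u + t%:C * v) <= B.
  move=> /andP[t0 t1]; apply: le_trans uvB.
  by rewrite (le_trans (cmodD _ _)) // lerD2l cmodM cmod_real ger0_norm // ler_piMl ?cmod_ge0.
set E := _ * expR B.
have step t : 0 <= t <= 1 ->
    cmod (exp_tail K.-1 (u + t%:C * v) - exp_tail K.-1 u) <= 2 * (cmod v * E).
  move=> /andP[t0 t1].
  (* The segment from [u] to [u + t v], again parametrised by [[0, 1]]. *)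
  have := @cderive_le (fun x => exp_tail K.-1 (u + x%:C * (t%:C * v))) _ (cmod v * E)
    (cderive_exp_tail K.-1 u (t%:C * v)).
  rewrite !mul0r !mul1r addr0; apply => x /andP[x0 x1].
  rewrite mulrA -rmorphM cmodM; apply: ler_pM; rewrite ?cmod_ge0 //.
    by rewrite cmodM cmod_real ger0_norm // ler_piMl ?cmod_ge0.
  by apply/exp_tail_le_bound/line; rewrite mulr_ge0 //= mulr_ile1.
have der t : cderive (fun x => exp_tail K (u + x%:C * v) + (0 + x%:C * - (v * exp_tail K.-1 u)))
    t (v * (exp_tail K.-1 (u + t%:C * v) - exp_tail K.-1 u)).
  rewrite [X in cderive _ _ X]mulrBr.
  exact: (cderiveD (cderive_exp_tail K u v t) (cderive_line 0 (- (v * exp_tail K.-1 u)) t)).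
have := cderive_le der (M := cmod v * (2 * (cmod v * E))).
rewrite !mul0r !mul1r !addr0 add0r (_ : _ + _ - _ =
  exp_tail K (u + v) - exp_tail K u - v * exp_tail K.-1 u); last by ring.
rewrite (_ : 2 * (cmod v * (2 * (cmod v * E))) = 4 * cmod v ^+ 2 * E); last by rewrite expr2;
  ring.
apply => t t01; rewrite cmodM; apply: ler_wpM2l; rewrite ?cmod_ge0 //.
exact: step.
Qed.

End ComplexExponential.

(** * Series of functions with second-order expansions *)

Section ComplexSeries.
Variable R : realType.
Implicit Types (u v : nat -> R[i]) (s h w l : R[i]) (C r rho M N : R) (f g : R[i]^o -> R[i]^o).

Definition csum u : R[i] := limn (series (u : nat -> R[i]^o)).

Lemma csumP u (l : R[i]) : series (u : nat -> R[i]^o) @ \oo --> (l : R[i]^o) -> csum u = l.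
Proof. by move=> H; apply: cvg_lim H; exact: norm_hausdorff. Qed.

Lemma csum_cvg u C r : 0 <= r < 1 -> (forall n, cmod (u n) <= C * r ^+ n) ->
  series (u : nat -> R[i]^o) @ \oo --> (csum u : R[i]^o).
Proof.
move=> /andP[r0 r1] uC.
have bnd (p : R[i] -> R) : (forall w, `|p w| <= cmod w) ->
    cvgn (series (fun n => p (u n))).
  move=> pw; apply: normed_cvg; apply: (@series_le_cvg _ _ (geometric C r)) => //.
  - by move=> n /=.
  - by move=> n; exact: le_trans (cmod_ge0 _) (uC n).
  - by move=> n; apply: le_trans (pw _) (uC n).
  - by apply: is_cvg_geometric_series; rewrite ger0_norm.
have /cvg_ex[a /cvgrPdist_lt Ha] := bnd _ (@Re_le_cmod R).
have /cvg_ex[b /cvgrPdist_lt Hb] := bnd _ (@Im_le_cmod R).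
suff H : series (u : nat -> R[i]^o) @ \oo --> (a +i* b : R[i]^o).
  by rewrite (csumP H).
apply/cvg_cmod => e e0; have e2 : 0 < e / 2 by rewrite divr_gt0.
move: (Ha _ e2) (Hb _ e2); apply: filterS2 => n Han Hbn.
apply: le_lt_trans (cmod_le_ReIm _) _; rewrite ReD ImD ReN ImN /=.
have -> : complex.Re (series (u : nat -> R[i]^o) n) = series (fun n => complex.Re (u n)) n.
  by rewrite /series /=; elim/big_ind2 : _ => //= ? ? ? ? <- <-; exact: ReD.
have -> : complex.Im (series (u : nat -> R[i]^o) n) = series (fun n => complex.Im (u n)) n.
  by rewrite /series /=; elim/big_ind2 : _ => //= ? ? ? ? <- <-; exact: ImD.
by rewrite (splitr e) ltrD // distrC.
Qed.

Lemma csum_le u C r : 0 <= r < 1 -> (forall n, cmod (u n) <= C * r ^+ n) ->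
  cmod (csum u) <= C / (1 - r).
Proof.
move=> r01 uC; have /cvg_cmod H := csum_cvg r01 uC.
have C0 : 0 <= C by have := le_trans (cmod_ge0 _) (uC 0%N); rewrite expr0 mulr1.
case/andP: r01 => r0 r1; have r1' : 0 < 1 - r by rewrite subr_gt0.
apply/ler_addgt0Pr => e e0; have [n _ /(_ n (leqnn n)) /ltW Hn] := H e e0.
rewrite -[csum u](subrK (series (u : nat -> R[i]^o) n)) addrC.
apply: le_trans (cmodD _ _) _; apply: lerD; last by rewrite cmodC.
apply: le_trans (cmod_sum _ _ _) _.
apply: le_trans (ler_sum _ (fun i _ => uC i)) _.
rewrite (_ : \sum_(_ <= _ < _) _ = series (geometric C r) n) //.
rewrite geometric_seriesE ?lt_eqF //= ler_pM2r ?invr_gt0 // ler_piMr //.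
by rewrite lerBlDr lerDl exprn_ge0.
Qed.

Lemma seriesE u n : series (u : nat -> R[i]^o) n = \sum_(i < n) u i.
Proof. by rewrite /series /= big_mkord. Qed.

Lemma csumD u v (a b : R[i]) :
  series (u : nat -> R[i]^o) @ \oo --> (a : R[i]^o) ->
  series (v : nat -> R[i]^o) @ \oo --> (b : R[i]^o) ->
  series ((fun n => u n + v n) : nat -> R[i]^o) @ \oo --> (a + b : R[i]^o).
Proof.
move=> ua vb.
have E : series ((fun n => u n + v n) : nat -> R[i]^o) =
    (fun n => series (u : nat -> R[i]^o) n + series (v : nat -> R[i]^o) n).
  by apply/funext => n; rewrite !seriesE big_split.
rewrite E; exact: cvgD ua vb.
Qed.

Lemma csumZ u w (a : R[i]) :
  series (u : nat -> R[i]^o) @ \oo --> (a : R[i]^o) ->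
  series ((fun n => w * u n) : nat -> R[i]^o) @ \oo --> (w * a : R[i]^o).
Proof.
move=> ua; have E : series ((fun n => w * u n) : nat -> R[i]^o) =
    (fun n => w * series (u : nat -> R[i]^o) n).
  by apply/funext => n; rewrite !seriesE mulr_sumr.
rewrite E; apply: cvgM ua; exact: cvg_cst.
Qed.

Lemma csum_geometric w : cmod w < 1 ->
  series ((fun n => w ^+ n) : nat -> R[i]^o) @ \oo --> ((1 - w)^-1 : R[i]^o).
Proof.
move=> w1; have r01 : 0 <= cmod w < 1 by rewrite cmod_ge0.
have H : series ((fun n => w ^+ n) : nat -> R[i]^o) @ \oo --> (csum (fun n => w ^+ n) : R[i]^o).
  by apply: (@csum_cvg _ 1 _ r01) => n; rewrite cmodX mul1r.
have H0 : series ((fun n => w ^+ n) : nat -> R[i]^o) @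
    \oo --> (1 + w * csum (fun n => w ^+ n) : R[i]^o).
  have E : (fun n => series ((fun n => w ^+ n) : nat -> R[i]^o) n.+1) =
      (fun n => 1 + series ((fun n => w * w ^+ n) : nat -> R[i]^o) n).
    apply/funext => n; rewrite !seriesE big_ord_recl expr0; congr (_ + _).
    by apply: eq_bigr => i _; rewrite exprS.
  rewrite -cvg_shiftS E; apply: cvgD; [exact: cvg_cst|exact: csumZ].
have E : csum (fun n => w ^+ n) = 1 + w * csum (fun n => w ^+ n).
  by rewrite -[RHS](csumP H0).
have w0 : 1 - w != 0.
  by apply/eqP => /subr0_eq ww; move: w1; rewrite -ww cmod1 ltxx.
have -> : (1 - w)^-1 = csum (fun n => w ^+ n); last exact: H.
by apply: (mulfI w0); rewrite mulfV // mulrBl mul1r {1}E addrK.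
Qed.

(** [f] and its derivative [d] at [s] are bounded by [M], and [M] also controls the second-order
error on the disc of radius [rho].  A single constant for the three bounds makes the notion stable
under products and under summation of series. *)
Definition quad_approx f s rho M := exists d : R[i],
  [/\ cmod (f s) <= M, cmod d <= M &
      forall h, cmod h <= rho -> cmod (f (s + h) - f s - h * d) <= M * cmod h ^+ 2].

Lemma quad_approx_ge0 f s rho M : quad_approx f s rho M -> 0 <= M.
Proof. by move=> [d [/(le_trans (cmod_ge0 _))]]. Qed.

Lemma quad_approxW f s rho M N : M <= N -> quad_approx f s rho M -> quad_approx f s rho N.
Proof.
move=> MN [d [H1 H2 H3]]; exists d; split; [exact: le_trans MN|exact: le_trans MN|].
by move=> h /H3 /le_trans; apply; rewrite ler_wpM2r ?sqr_ge0.
Qed.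

Lemma quad_approx_cst c s rho : quad_approx (fun=> c) s rho (cmod c).
Proof.
exists 0; rewrite cmod0 cmod_ge0 lexx; split => // h _.
by rewrite mulr0 !subrr cmod0 mulr_ge0 ?cmod_ge0 ?sqr_ge0.
Qed.

Lemma quad_approx_id s rho : quad_approx id s rho (cmod s + 1).
Proof.
exists 1; rewrite cmod1 lerDl lerDr cmod_ge0 ler01; split=> // h _.
by rewrite mulr1 [s + h]addrC addrK subrr cmod0 mulr_ge0 ?sqr_ge0 // addr_ge0 ?cmod_ge0.
Qed.

Lemma quad_approxD f g s rho M N : quad_approx f s rho M -> quad_approx g s rho N ->
  quad_approx (fun t => f t + g t) s rho (M + N).
Proof.
move=> [d [H1 H2 H3]] [e [G1 G2 G3]]; exists (d + e); split.
- by rewrite (le_trans (cmodD _ _)) ?lerD.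
- by rewrite (le_trans (cmodD _ _)) ?lerD.
move=> h hr; rewrite (_ : _ - _ = (f (s + h) - f s - h * d) + (g (s + h) - g s - h * e));
  last by ring.
by rewrite (le_trans (cmodD _ _)) // mulrDl lerD ?H3 ?G3.
Qed.

(** The error of a product is the sum of [h ^ 2 f' g'], of an error of [f] times a value of
[g], and of an error of [g] times a value of the linearisation of [f]: at most
[(1 + 3 + 2) M N |h| ^ 2]. *)
Lemma quad_approxM f g s rho M N : rho <= 1 -> quad_approx f s rho M -> quad_approx g s rho N ->
  quad_approx (fun t => f t * g t) s rho (6 * M * N).
Proof.
move=> r1 Hf Hg; have M0 := quad_approx_ge0 Hf; have N0 := quad_approx_ge0 Hg.
have MN0 : 0 <= M * N by rewrite mulr_ge0.
move: Hf Hg => [d [H1 H2 H3]] [e [G1 G2 G3]].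
have b (a c : R[i]) (A C : R) : 0 <= A -> 0 <= C ->
    cmod a <= A -> cmod c <= C -> cmod (a * c) <= A * C.
  by move=> A0 C0 aA cC; rewrite cmodM ler_pM ?cmod_ge0.
exists (d * g s + f s * e); split.
- by apply: le_trans (b _ _ _ _ M0 N0 H1 G1) _; rewrite -mulrA ler_peMl // ler1n.
- apply: le_trans (cmodD _ _) _.
  apply: le_trans (lerD (b _ _ _ _ M0 N0 H2 G1) (b _ _ _ _ M0 N0 H1 G2)) _.
  lra.
move=> h hr; have h0 := cmod_ge0 h.
set p := f (s + h) - f s - h * d; set q := g (s + h) - g s - h * e.
have fE : f (s + h) = f s + h * d + p by rewrite /p; ring.
have gE : g (s + h) = g s + h * e + q by rewrite /q; ring.
have h1 : cmod h <= 1 by exact: le_trans r1.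
have h2 : 0 <= cmod h ^+ 2 <= 1 by rewrite exprn_ge0 //= expr_le1.
have hM (x : R) : 0 <= x -> cmod h * x <= x by move=> x0; rewrite ler_piMl.
have h2M (x : R) : 0 <= x -> x * cmod h ^+ 2 <= x.
  by move=> x0; case/andP: h2 => _ ?; rewrite ler_piMr.
have g3 : cmod (g (s + h)) <= 3 * N.
  rewrite gE; apply: le_trans (cmodD _ _) _.
  rewrite (_ : 3 * N = N + N + N); last by ring.
  apply: lerD; last by apply: le_trans (G3 _ hr) (h2M _ N0).
  apply: le_trans (cmodD _ _) _; apply: lerD => //.
  by rewrite cmodM; apply: le_trans (hM _ N0); rewrite ler_wpM2l.
have f2 : cmod (f s + h * d) <= 2 * M.
  rewrite (_ : 2 * M = M + M); last by ring.
  apply: le_trans (cmodD _ _) _; apply: lerD => //.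
  by rewrite cmodM; apply: le_trans (hM _ M0); rewrite ler_wpM2l.
rewrite (_ : _ - _ = (h ^+ 2 * (d * e) + p * g (s + h)) + (f s + h * d) * q); last first.
  by rewrite fE gE; ring.
have p0 : 0 <= M * cmod h ^+ 2 by rewrite mulr_ge0 ?sqr_ge0.
have q0 : 0 <= N * cmod h ^+ 2 by rewrite mulr_ge0 ?sqr_ge0.
rewrite (_ : 6 * M * N * _ = (cmod h ^+ 2 * (M * N) + M * cmod h ^+ 2 * (3 * N)) +
  2 * M * (N * cmod h ^+ 2)); last by ring.
apply: le_trans (cmodD _ _) _; apply: lerD; last by apply: b; rewrite ?G3 ?mulr_ge0.
apply: le_trans (cmodD _ _) _; apply: lerD; last by apply: b; rewrite ?H3 ?mulr_ge0.
by rewrite cmodM cmodX ler_wpM2l ?sqr_ge0 // b.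
Qed.

Lemma quad_approx_derivable f s rho M : 0 < rho -> quad_approx f s rho M -> derivable f s 1.
Proof. by move=> rho0 [d [_ _ H]]; exact: derivable_quad H. Qed.

Lemma quad_approx_le f s rho M h : rho <= 1 -> cmod h <= rho -> quad_approx f s rho M ->
  cmod (f (s + h)) <= 3 * M.
Proof.
move=> r1 hr Hf; have M0 := quad_approx_ge0 Hf; case: Hf => d [H1 H2 H3].
have h0 := cmod_ge0 h; have h1 : cmod h <= 1 by exact: le_trans r1.
rewrite (_ : f (s + h) = f s + h * d + (f (s + h) - f s - h * d)); last by ring.
rewrite (_ : 3 * M = M + M + M); last by ring.
apply: le_trans (cmodD _ _) _; apply: lerD; last first.
  by apply: le_trans (H3 _ hr) _; rewrite ler_piMr // expr_le1.
apply: le_trans (cmodD _ _) _; apply: lerD => //.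
by rewrite cmodM -[M]mul1r ler_pM ?cmod_ge0.
Qed.

Lemma quad_approx_poly (p : {poly R[i]}) s rho : rho <= 1 ->
  exists M, quad_approx (horner p) s rho M.
Proof.
move=> r1; elim/poly_ind: p => [|p c [M HM]].
  exists (cmod 0); rewrite (_ : horner _ = fun=> 0) ?funeqE; first exact: quad_approx_cst.
  by move=> x; rewrite horner0.
exists (6 * M * (cmod s + 1) + cmod c).
rewrite (_ : horner _ = fun t => p.[t] * t + c).
  by apply: quad_approxD; [apply: quad_approxM => //;
    exact: quad_approx_id|exact: quad_approx_cst].
by apply/funext => x; rewrite hornerMXaddC.
Qed.

(** Termwise differentiation: the errors add up to a convergent geometric series, so the sum
of the derivatives is the derivative of the sum. *)
Lemma quad_approx_csum (f : nat -> R[i]^o -> R[i]^o) s rho C r : 0 < rho <= 1 -> 0 <= r < 1 ->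
  (forall n, quad_approx (f n) s rho (C * r ^+ n)) ->
  (forall t, cmod (t - s) <= rho ->
     series (f^~ t) @ \oo --> (csum (f^~ t) : R[i]^o)) /\
  quad_approx (fun t => csum (f^~ t)) s rho (C / (1 - r)).
Proof.
move=> /andP[rho0 rho1] r01 H.
have cv t : cmod (t - s) <= rho -> series (f^~ t) @ \oo --> (csum (f^~ t) : R[i]^o).
  move=> ts; apply: (@csum_cvg _ (3 * C) _ r01) => n.
  by have := quad_approx_le rho1 ts (H n); rewrite addrC subrK mulrA.
split=> //.
have /choice[d Hd] n : exists d : R[i], [/\ cmod (f n s) <= C * r ^+ n, cmod d <= C * r ^+ n &
      forall h, cmod h <= rho -> cmod (f n (s + h) - f n s - h * d) <= C * r ^+ n * cmod h ^+ 2].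
  exact: H.
have dcv : series (d : nat -> R[i]^o) @ \oo --> (csum d : R[i]^o).
  by apply: (@csum_cvg _ C _ r01) => n; case: (Hd n).
exists (csum d); split.
- by apply: csum_le => // n; case: (Hd n).
- by apply: csum_le => // n; case: (Hd n).
move=> h hr.
have c1 : series (f^~ (s + h)) @ \oo --> (csum (f^~ (s + h)) : R[i]^o).
  by apply: cv; rewrite addrAC subrr add0r.
have c2 : series (f^~ s) @ \oo --> (csum (f^~ s) : R[i]^o).
  by apply: cv; rewrite subrr cmod0 ltW.
have := csumD (csumD c1 (csumZ (w := -1) c2)) (csumZ (w := - h) dcv).
move=> /csumP; rewrite mulN1r mulNr => <-.
rewrite mulrAC; apply: csum_le => // n.
rewrite mulN1r mulNr mulrAC.
by case: (Hd n) => _ _; apply.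
Qed.

End ComplexSeries.

(** * Interpolation and the binomial remainder *)

Section Lagrange.
Variables (F : fieldType) (n : nat) (x : 'I_n -> F).

Definition lagrange_poly (i : 'I_n) : {poly F} :=
  \prod_(j | j != i) ((x i - x j)^-1 *: ('X - (x j)%:P)).

Lemma size_lagrange_poly i : (size (lagrange_poly i) <= n)%N.
Proof.
rewrite /lagrange_poly scaler_prod; apply: leq_trans (size_scale_leq _ _) _.
rewrite -big_filter size_prod_XsubC -sum1_size big_filter sum1_card cardC1 card_ord.
by case: (n) i => [[]|].
Qed.

Hypothesis x_inj : injective x.

Lemma lagrange_poly_sample i j : (lagrange_poly i).[x j] = (i == j)%:R.
Proof.
rewrite /lagrange_poly horner_prod; have [<-|ij] := eqVneq i j.
  apply: big1 => k ki; rewrite hornerZ hornerXsubC mulVf // subr_eq0.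
  by apply: contra ki => /eqP/x_inj ->.
by rewrite (bigD1 j) 1?eq_sym //= hornerZ hornerXsubC subrr mulr0 mul0r.
Qed.

Lemma lagrange_interpolation (q : {poly F}) : (size q <= n)%N ->
  q = \sum_i q.[x i] *: lagrange_poly i.
Proof.
move=> qn; apply/eqP; rewrite -subr_eq0; apply/eqP.
apply: (@roots_geq_poly_eq0 _ _ [seq x i | i <- enum 'I_n]).
- apply/allP => _ /mapP[i _ ->]; rewrite rootE !hornerE horner_sum (bigD1 i) //=.
  rewrite hornerZ lagrange_poly_sample eqxx mulr1 big1 ?addr0 ?subrr // => j ji.
  by rewrite hornerZ lagrange_poly_sample (negPf ji) mulr0.
- by rewrite map_inj_uniq ?enum_uniq.
- rewrite size_map size_enum_ord; apply: leq_trans (size_polyD _ _) _.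
  rewrite size_polyN geq_max qn; apply: leq_trans (size_sum _ _ _) _.
  apply/bigmax_leqP => i _; apply: leq_trans (size_scale_leq _ _) _.
  exact: size_lagrange_poly.
Qed.
End Lagrange.

Section Binomial.
Variable R : realType.
Implicit Types (s h w l : R[i]) (C r rho M N X x eps : R).

Lemma cbinom_nat (N k : nat) : cbinom (N%:R : R[i]) k = ('C(N, k))%:R.
Proof.
rewrite /cbinom.
have -> : \prod_(i < k) (N%:R - i%:R) = (N ^_ k)%:R :> R[i].
  elim: k => [|k IH]; first by rewrite big_ord0 ffactn0.
  rewrite big_ord_recr /= IH ffactnSr natrM.
  have [kN|Nk] := leqP k N; first by rewrite natrB.
  by rewrite ffact_small // !mul0r.
by rewrite -bin_ffact natrM mulfK // pnatr_eq0 -lt0n fact_gt0.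
Qed.

Definition cbinom_poly k : {poly R[i]} :=
  (k`!%:R)^-1 *: \prod_(i < k) ('X - (i%:R)%:P).

Lemma horner_cbinom_poly k w : (cbinom_poly k).[w] = cbinom w k.
Proof.
rewrite /cbinom_poly hornerZ horner_prod mulrC; congr (_ * _).
by apply: eq_bigr => i _; rewrite hornerXsubC.
Qed.

Lemma size_cbinom_poly k : (size (cbinom_poly k) <= k.+1)%N.
Proof.
apply: leq_trans (size_scale_leq _ _) _.
by rewrite size_prod_XsubC /index_enum -enumT size_enum_ord.
Qed.

Definition binom_rem K s eps : R[i] :=
  cexp (- s * (ln (1 + eps))%:C) - \sum_(k < K) cbinom (- s) k * eps%:C ^+ k.

Let node K (i : 'I_K) : R[i] := (i : nat)%:R.

Lemma node_inj K : injective (@node K).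
Proof. by move=> i j /eqP; rewrite eqr_nat => /eqP/val_inj. Qed.

(** Subtracting the Taylor polynomial of [e ^ (x L)], with [L = ln (1 + eps)], from the
truncated binomial series in [x] leaves a polynomial [q] in [x] of degree less than [K].  At
[x = N < K] the truncated binomial series is exactly [(1 + eps) ^ N = e ^ (N L)], so that [q]
takes there the value [exp_tail K (N L)]; interpolation recovers [q] at [x = - s]. *)
Lemma binom_remE K s eps : -1 < eps ->
  binom_rem K s eps = exp_tail K (- s * (ln (1 + eps))%:C) -
    \sum_(N < K) exp_tail K (N%:R * (ln (1 + eps))%:C) * (lagrange_poly (@node K) N).[- s].
Proof.
move=> eps1; set L := (ln (1 + eps))%:C.
have e0 : 0 < 1 + eps by rewrite -(ltrD2l (-1)) addrA addNr add0r addr0.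
(* As a polynomial in the variable [- s]. *)
pose q : {poly R[i]} := \sum_(k < K) eps%:C ^+ k *: cbinom_poly k -
   \sum_(j < K) (L ^+ j / j`!%:R) *: 'X^j.
have qE w : q.[w] = \sum_(k < K) cbinom w k * eps%:C ^+ k - \sum_(j < K) (w * L) ^+ j / j`!%:R.
  rewrite /q hornerD hornerN !horner_sum; congr (_ - _); apply: eq_bigr => k _.
    by rewrite hornerZ horner_cbinom_poly mulrC.
  by rewrite hornerZ hornerXn exprMn mulrC mulrA.
have sq : (size q <= K)%N.
  rewrite /q; apply: leq_trans (size_polyD _ _) _.
  rewrite size_polyN geq_max; apply/andP; split.
    apply: leq_trans (size_sum _ _ _) _; apply/bigmax_leqP => i _.
    apply: leq_trans (size_scale_leq _ _) _; apply: leq_trans (size_cbinom_poly _) _.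
    exact: ltn_ord.
  apply: leq_trans (size_sum _ _ _) _; apply/bigmax_leqP => i _.
  by apply: leq_trans (size_scale_leq _ _) _; rewrite size_polyXn.
have qN (N : 'I_K) : q.[node N] = exp_tail K (N%:R * L).
  rewrite qE /exp_tail; congr (_ - _).
  rewrite cexpM_nat cexp_real lnK ?posrE // rmorphD rmorph1 exprDn_comm; last exact: mulrC.
  rewrite -(big_mkord xpredT (fun k => cbinom (node N) k * eps%:C ^+ k)).
  rewrite (big_cat_nat (n := N.+1)) //= big_mkord [X in _ + X]big1_seq ?addr0 => [|k].
    by apply: eq_bigr => k _; rewrite cbinom_nat expr1n mul1r mulr_natl.
  by rewrite mem_index_iota /= => /andP[Nk _]; rewrite cbinom_nat bin_small ?mul0r.
transitivity (exp_tail K (- s * L) - q.[- s]).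
  by rewrite qE /binom_rem /exp_tail -/L; ring.
rewrite [in LHS](lagrange_interpolation (@node_inj K) sq) horner_sum.
by congr (_ - _); apply: eq_bigr => N _; rewrite hornerZ qN.
Qed.

Lemma quad_approx_sum I (r : seq I) (f : I -> R[i]^o -> R[i]^o) s rho (M : I -> R) :
  (forall i, quad_approx (f i) s rho (M i)) ->
  quad_approx (fun t => \sum_(i <- r) f i t) s rho (\sum_(i <- r) M i).
Proof.
move=> H; elim: r => [|i r IH].
  rewrite big_nil (_ : (fun t => _) = fun=> 0).
    by rewrite -cmod0; exact: quad_approx_cst.
  by apply/funext => t; rewrite big_nil.
rewrite big_cons (_ : (fun t => _) = fun t => f i t + \sum_(j <- r) f j t).
  exact: quad_approxD.
by apply/funext => t; rewrite big_cons.
Qed.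

(** Here [x] plays the role of [ln (1 + eps_n)], so that the constant decays like [|x| ^ K],
uniformly for [x] in a bounded set. *)
Lemma quad_approx_exp_tail K s rho X : rho <= 1 -> exists2 C, 0 <= C &
  forall x, `|x| <= X -> quad_approx (fun t => exp_tail K (- t * x%:C)) s rho (C * `|x| ^+ K).
Proof.
move=> r1; pose B := cmod s + 1.
have [X0|X0] := ltP X 0.
  exists 0 => // x /(le_trans (normr_ge0 _)) /le_lt_trans/(_ X0).
  by rewrite ltxx.
have B1 : 1 <= B by rewrite lerDr cmod_ge0.
have B0 : 0 <= B := le_trans ler01 B1.
(* The factor [(1 + X) ^ 2] absorbs up to two excess powers of [|x|]; they occur for [K < 2]. *)
pose C := 4 * (1 + X) ^+ 2 * (2 * B) ^+ K * expR (B * X).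
have X1 : 1 <= (1 + X) ^+ 2 by rewrite expr_ge1 ?lerDl // addr_ge0.
have C0 : 0 <= C by rewrite !mulr_ge0 ?expR_ge0 ?exprn_ge0 ?addr_ge0 ?mulr_ge0.
exists C => // x xX.
have x0 := normr_ge0 x.
have pw m : (K <= m <= K.+2)%N -> `|x| ^+ m <= (1 + X) ^+ 2 * `|x| ^+ K.
  move=> /andP[Km mK]; rewrite -(subnK Km) exprD ler_wpM2r ?exprn_ge0 //.
  have mk2 : (m - K <= 2)%N by rewrite leq_subLR addn2.
  apply: le_trans (_ : (1 + X) ^+ (m - K) <= _).
    by rewrite lerXn2r ?nnegrE ?addr_ge0 // (le_trans xX) // lerDr.
  by rewrite ler_weXn2l // lerDl.
have bd c m j : 0 <= c <= 4 -> (K <= m + j <= K.+2)%N -> (m <= K)%N ->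
    c * (2 * (B * `|x|)) ^+ m * `|x| ^+ j * expR (B * `|x|) <= C * `|x| ^+ K.
  move=> /andP[c0 c4] mj mK.
  rewrite mulrA exprMn (mulrA c) -(mulrA _ (`|x| ^+ m)) -exprD.
  have e1 : expR (B * `|x|) <= expR (B * X) by rewrite ler_expR ler_wpM2l.
  rewrite /C (_ : 4 * _ * _ * _ * _ =
    (4 * (2 * B) ^+ K) * ((1 + X) ^+ 2 * `|x| ^+ K) * expR (B * X)); last by ring.
  have b0 : 0 <= (2 * B) ^+ m by rewrite exprn_ge0 // mulr_ge0.
  have xm0 : 0 <= `|x| ^+ (m + j) by rewrite exprn_ge0.
  apply: ler_pM => //; rewrite ?expR_ge0 //; first by rewrite !mulr_ge0.
  apply: ler_pM; rewrite ?exprn_ge0 ?mulr_ge0 ?pw //.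
  by apply: ler_pM => //; rewrite ler_weXn2l // (le_trans B1) // ler_peMl // ler1n.
have xB t : cmod t <= B -> cmod (- t * x%:C) <= B * `|x|.
  by move=> tB; rewrite cmodM cmodN cmod_real ler_wpM2r.
have sB : cmod s <= B by rewrite lerDl.
exists (- x%:C * exp_tail K.-1 (- s * x%:C)); split.
- apply: le_trans (exp_tail_le_bound _ (xB _ sB)) _.
  have := bd 1 K 0%N; rewrite mul1r expr0 mulr1 addn0 leqnn leqW // ler01 ler1n.
  exact.
- rewrite cmodM cmodN cmod_real.
  apply: le_trans (ler_wpM2l x0 (exp_tail_le_bound _ (xB _ sB))) _.
  have := bd 1 K.-1 1%N; rewrite mul1r expr1 addn1 ler01 ler1n leq_pred => H.
  rewrite (_ : `|x| * _ = (2 * (B * `|x|)) ^+ K.-1 * `|x| * expR (B * `|x|)); last by ring.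
  by apply: H => //; lia.
move=> h hr; rewrite (_ : - (s + h) * x%:C = - s * x%:C + - h * x%:C); last by ring.
have h0 := cmod_ge0 h.
rewrite (_ : _ - h * _ = exp_tail K (- s * x%:C + - h * x%:C) - exp_tail K (- s * x%:C) -
  (- h * x%:C) * exp_tail K.-1 (- s * x%:C)); last by ring.
have shB : cmod (- s * x%:C) + cmod (- h * x%:C) <= B * `|x|.
  rewrite !cmodM !cmodN cmod_real -mulrDl ler_wpM2r // lerD2l.
  exact: le_trans r1.
apply: le_trans (exp_tail_quad K shB) _.
rewrite cmodM cmodN cmod_real exprMn.
rewrite (_ : 4 * _ * _ = 4 * (2 * (B * `|x|)) ^+ K.-2 * `|x| ^+ 2 * expR (B * `|x|) *
  cmod h ^+ 2); last by ring.
rewrite ler_wpM2r ?sqr_ge0 //; apply: bd; rewrite ?lexx ?ler0n //.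
  by lia.
by lia.
Qed.

(** In the identity [binom_remE] only the factors [exp_tail K (N L)] and [exp_tail K (- s L)]
depend on [eps], and both are [O(|L| ^ K)]. *)
Lemma quad_approx_binom_rem K s rho X : rho <= 1 -> exists2 C, 0 <= C &
  forall eps, -1 < eps -> `|ln (1 + eps)| <= X ->
    quad_approx (fun t => binom_rem K t eps) s rho (C * `|ln (1 + eps)| ^+ K).
Proof.
move=> r1; have [C C0 HC] := quad_approx_exp_tail K s X r1.
have /choice[M HM] (N : 'I_K) :
    exists M, quad_approx (fun t => (lagrange_poly (@node K) N).[- t]) s rho M.
  have [M HM] := quad_approx_poly (lagrange_poly (@node K) N \Po (- 'X)) s r1.
  exists M; rewrite (_ : (fun t => _) = horner (lagrange_poly (@node K) N \Po (- 'X))) //.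
  by apply/funext => t; rewrite horner_comp !hornerE.
have M0 (N : 'I_K) : 0 <= M N := quad_approx_ge0 (HM N).
have [X0|X0] := ltP X 0.
  exists 0 => // e _ /(le_trans (normr_ge0 _)) /le_lt_trans/(_ X0).
  by rewrite ltxx.
pose D (N : 'I_K) := (2 * N%:R) ^+ K * expR (N%:R * X).
have D0 (N : 'I_K) : 0 <= D N by rewrite mulr_ge0 ?expR_ge0 ?exprn_ge0.
exists (C + \sum_(N < K) 6 * D N * M N).
  by rewrite addr_ge0 ?sumr_ge0 // => N _; rewrite !mulr_ge0.
move=> eps eps1 eX; set L := ln (1 + eps) in eX *.
rewrite (_ : (fun t => _) = (fun t => exp_tail K (- t * L%:C) +
    \sum_(N < K) (- exp_tail K (N%:R * L%:C)) * (lagrange_poly (@node K) N).[- t])); last first.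
  by apply/funext => t; rewrite binom_remE // -/L -sumrN; congr (_ + _); apply: eq_bigr => N _;
    rewrite mulNr.
rewrite mulrDl; apply: quad_approxD; first exact: HC.
rewrite mulr_suml; apply: quad_approx_sum => N.
rewrite [X in quad_approx _ _ _ X](_ : _ = 6 * (D N * `|L| ^+ K) * M N); last by ring.
apply: quad_approxM => //; apply: quad_approxW (quad_approx_cst _ _ _).
rewrite cmodN.
have NL : cmod (N%:R * L%:C) <= N%:R * `|L|.
  by rewrite cmodM cmod_real
    -[N%:R]/((N%:R : R[i])) -(rmorph_nat (real_complex R)) cmod_real ger0_norm.
apply: le_trans (exp_tail_le_bound K NL) _.
rewrite [leRHS](_ : _ = (2 * (N%:R * `|L|)) ^+ K * expR (N%:R * X)); last first.
  by rewrite /D mulrA [in RHS]exprMn mulrAC.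
rewrite ler_wpM2l ?exprn_ge0 ?mulr_ge0 //.
by rewrite ler_expR ler_wpM2l.
Qed.

(** The frequency [n l] of the [n]-th power grows with [n], and its square enters the error
term.  Shrinking the radius keeps [e ^ (n l |h|)], and with it every polynomial in [n], below the
gap between [|z e ^ (- s l)| ^ n] and [r ^ n]. *)
Lemma quad_approx_exp_power (z : R[i]) (l : R) s r : 0 < l ->
  cmod (z * cexp (- s * l%:C)) < r ->
  exists rho C, [/\ 0 < rho, rho <= 1, 0 <= C &
    forall n, quad_approx (fun t => (z * cexp (- t * l%:C)) ^+ n) s rho (C * r ^+ n)].
Proof.
move=> l0 wr; set w := z * _ in wr.
have r0 : 0 < r := le_lt_trans (cmod_ge0 _) wr.
have [rho /andP[rho0 rho1] Hrho] :
    exists2 rho : R, 0 < rho <= 1 & cmod w * expR (rho * (l + l)) <= r.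
  have [w0|w0] := eqVneq (cmod w) 0.
    by exists 1; rewrite ?ltr01 ?lexx // w0 mul0r ltW.
  have wp : 0 < cmod w by rewrite lt_def w0 cmod_ge0.
  have rw : 1 < r / cmod w by rewrite ltr_pdivlMr // mul1r.
  have l2 : 0 < l + l by rewrite addr_gt0.
  exists (Num.min 1 (ln (r / cmod w) / (l + l))).
    by rewrite lt_min ltr01 divr_gt0 ?ln_gt0 //= ge_min lexx.
  rewrite mulrC -ler_pdivlMr //; apply: le_trans (_ : expR (ln (r / cmod w)) <= _).
    by rewrite ler_expR -ler_pdivlMr // ge_min lexx orbT.
  by rewrite lnK // posrE (lt_trans ltr01).
pose C := 1 + rho^-1 + 16 / rho ^+ 2.
have ri : 0 <= rho^-1 by rewrite invr_ge0 ltW.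
have ri2 : 0 <= 16 / rho ^+ 2 by rewrite divr_ge0 ?sqr_ge0.
have C0 : 0 <= C by rewrite !addr_ge0.
exists rho, C; split=> // n.
set x := n%:R * l; have x0 : 0 <= x by rewrite mulr_ge0 // ltW.
have xr0 : 0 <= x * rho by rewrite mulr_ge0 // ltW.
have E1 : 1 <= expR (x * rho) by rewrite -expR0 ler_expR.
have E2 : x <= rho^-1 * expR (x * rho).
  by rewrite ler_pdivlMl // mulrC (le_trans _ (expR_ge1Dx _)) // lerDr.
(* From [e ^ (2 y) = (e ^ y) ^ 2 >= y ^ 2] with [2 y = x rho]. *)
have E3 : 4 * x ^+ 2 <= 16 / rho ^+ 2 * expR (x * rho).
  have rr : 0 < rho ^+ 2 by rewrite exprn_gt0.
  rewrite mulrAC ler_pdivlMr // -mulrA -exprMn.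
  have := expR_ge1Dx (x * rho / 2); set y := x * rho / 2 => yE.
  have -> : x * rho = y + y by rewrite /y -splitr.
  have y0 : 0 <= y by rewrite divr_ge0.
  rewrite expRD.
  have : y * y <= expR y * expR y by rewrite ler_pM // (le_trans _ yE) // lerDr.
  by move=> H; rewrite expr2; lra.
have wn : cmod (w ^+ n) * (expR (x * rho) * expR (x * rho)) <= r ^+ n.
  rewrite -expRD cmodX (_ : x * rho + x * rho = n%:R * (rho * (l + l))); last by rewrite /x; ring.
  rewrite expRM_natl -exprMn lerXn2r ?nnegrE ?(ltW r0) // mulr_ge0 ?cmod_ge0 ?expR_ge0 //.
have eq1 t : (z * cexp (- t * l%:C)) ^+ n = z ^+ n * cexp (- t * x%:C).
  by rewrite exprMn -cexpM_nat; congr (_ * cexp _); rewrite /x rmorphM rmorph_nat; ring.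
have c1 := cmod_ge0 (w ^+ n).
have absorb2 A : 0 <= A -> A <= C * expR (x * rho) ->
    cmod (w ^+ n) * (A * expR (x * rho)) <= C * r ^+ n.
  move=> A0 leA; apply: le_trans (ler_wpM2l C0 wn).
  by rewrite [leRHS]mulrCA ler_wpM2l // mulrA ler_wpM2r ?expR_ge0 //.
have CE : expR (x * rho) + rho^-1 * expR (x * rho) + 16 / rho ^+ 2 * expR (x * rho) =
  C * expR (x * rho).
  by rewrite /C; ring.
have ex0 := expR_ge0 (x * rho).
have e1 : 0 <= rho^-1 * expR (x * rho) by rewrite mulr_ge0.
have e2 : 0 <= 16 / rho ^+ 2 * expR (x * rho) by rewrite mulr_ge0.
have absorb1 A : 0 <= A -> A <= C * expR (x * rho) -> cmod (w ^+ n) * A <= C * r ^+ n.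
  by move=> A0 leA; apply: le_trans (absorb2 _ A0 leA); rewrite ler_wpM2l // ler_peMr.
exists (w ^+ n * - x%:C); split.
- by rewrite -/w -[cmod _]mulr1; apply: absorb1 => //; lra.
- by rewrite cmodM cmodN cmod_real ger0_norm //; apply: absorb1 => //; lra.
move=> h hr.
have -> : (z * cexp (- (s + h) * l%:C)) ^+ n - (z * cexp (- s * l%:C)) ^+ n -
    h * (w ^+ n * - x%:C) = w ^+ n * exp_tail 2 (- h * x%:C).
  rewrite eq1 -/w (_ : - (s + h) * x%:C = - s * x%:C + - h * x%:C); last by ring.
  rewrite cexpD mulrA -eq1 -/w /exp_tail !big_ord_recl big_ord0 /= !expr0 expr1.
  by rewrite !divr1 addr0; ring.
have hx : cmod (- h * x%:C) = cmod h * x by rewrite cmodM cmodN cmod_real ger0_norm.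
rewrite cmodM; apply: le_trans (ler_wpM2l c1 (exp_tail_le _ _)) _.
rewrite hx.
rewrite (_ : cmod (w ^+ n) * _ =
  cmod (w ^+ n) * (4 * x ^+ 2 * expR (cmod h * x)) * cmod h ^+ 2); last by ring.
rewrite ler_wpM2r ?sqr_ge0 //; apply: le_trans (absorb2 (4 * x ^+ 2) _ _).
- have x2 : 0 <= 4 * x ^+ 2 by exact: mulr_ge0 (ler0n _ _) (sqr_ge0 _).
  rewrite ler_wpM2l // (ler_wpM2l x2) // ler_expR mulrC.
  exact: ler_wpM2l.
- by exact: mulr_ge0 (ler0n _ _) (sqr_ge0 _).
- by lra.
Qed.

End Binomial.

(** * Closed form of the recurrence *)

Section Functional.
Variables (K : fieldType) (b : nat -> K).
Implicit Types p q : {poly K}.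

(** The linear form on polynomials that sends ['X^i] to [b i].  A recurrence with characteristic
polynomial [P] says that it vanishes on the ideal generated by [P]. *)
Definition shift_functional q : K := \sum_(i < size q) q`_i * b i.

Lemma shift_functionalE N q : (size q <= N)%N -> shift_functional q = \sum_(i < N) q`_i * b i.
Proof.
move=> qN; rewrite /shift_functional.
rewrite (big_ord_widen_cond _ xpredT (fun i => q`_i * b i) qN).
rewrite [RHS](bigID (fun i : 'I_N => i < size q)%N) /=.
rewrite [X in _ = _ + X]big1 ?addr0 // => i; rewrite -leqNgt => si.
by rewrite nth_default // mul0r.
Qed.

Lemma shift_functionalD p q : shift_functional (p + q) = shift_functional p + shift_functional q.
Proof.
pose N := maxn (size p) (size q).
rewrite !(@shift_functionalE N) ?leq_maxl ?leq_maxr ?size_polyD //.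
by rewrite -big_split; apply: eq_bigr => i _; rewrite coefD mulrDl.
Qed.

Lemma shift_functionalZ c q : shift_functional (c *: q) = c * shift_functional q.
Proof.
rewrite (@shift_functionalE (size q)) ?size_scale_leq // mulr_sumr.
by apply: eq_bigr => i _; rewrite coefZ mulrA.
Qed.

Lemma shift_functional0 : shift_functional 0 = 0.
Proof. by rewrite /shift_functional size_poly0 big_ord0. Qed.

Lemma shift_functional_sum I (r : seq I) (P : pred I) (F : I -> {poly K}) :
  shift_functional (\sum_(i <- r | P i) F i) = \sum_(i <- r | P i) shift_functional (F i).
Proof. exact: (big_morph _ shift_functionalD shift_functional0). Qed.

Lemma shift_functionalXn n : shift_functional 'X^n = b n.
Proof.
rewrite /shift_functional size_polyXn big_ord_recr /= coefXn eqxx mul1r big1 ?add0r // => i _.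
by rewrite coefXn ltn_eqF ?mul0r.
Qed.

Lemma shift_functionalMXn p n : shift_functional (p * 'X^n) =
  \sum_(i < size p) p`_i * b (n + i)%N.
Proof.
rewrite -{1}[p]coefK poly_def mulr_suml shift_functional_sum; apply: eq_bigr => i _.
by rewrite -scalerAl -exprD shift_functionalZ shift_functionalXn addnC.
Qed.

Lemma shift_functional_ideal p q : (forall n, shift_functional (p * 'X^n) = 0) ->
  shift_functional (q * p) = 0.
Proof.
move=> H; rewrite -[q]coefK poly_def mulr_suml shift_functional_sum big1 // => i _.
by rewrite -scalerAl shift_functionalZ mulrC ['X^i * p]mulrC H mul0r.
Qed.

End Functional.

Section ClosedForm.
Variables (K : numFieldType) (d : nat) (a : nat -> int) (P : {poly int}).
Variable alpha : 'I_d.+1 -> K.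
Hypothesis P_monic : P \is monic.
Hypothesis P_ann : annihilates P a.
Hypothesis P_irr : irreducible_poly (map_poly intr P : {poly rat}).
Hypothesis P_roots : map_poly intr P = \prod_(i < d.+1) ('X - (alpha i)%:P).

Local Notation PQ := (map_poly intr P : {poly rat}).
Local Notation PK := (map_poly intr P : {poly K}).

Lemma map_ratr_intr (q : {poly int}) :
  map_poly ratr (map_poly intr q : {poly rat}) = map_poly intr q :> {poly K}.
Proof. by rewrite -map_poly_comp; apply: eq_map_poly => x /=; rewrite ratr_int. Qed.

Lemma size_PK : size PK = d.+2.
Proof. by rewrite P_roots size_prod_XsubC /index_enum -enumT size_enum_ord. Qed.

Lemma size_PQ : size PQ = d.+2.
Proof. by rewrite -(size_map_poly (@ratr K)) map_ratr_intr size_PK. Qed.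

Lemma size_P : size P = d.+2.
Proof. by rewrite -size_PQ size_map_inj_poly //; exact: intr_inj. Qed.

Lemma root_alpha i : root PK (alpha i).
Proof.
by rewrite P_roots rootE horner_prod (bigD1 i) //= hornerXsubC subrr mul0r.
Qed.

(** An irreducible polynomial is coprime to any nonzero polynomial of smaller degree, and
coprimality survives the extension of scalars. *)
Lemma irreducible_no_common_root (q : {poly rat}) i :
  q != 0 -> (size q < size PQ)%N -> ~~ root (map_poly ratr q) (alpha i).
Proof.
move=> q0 qP; rewrite rootE; apply: (@coprimep_root _ PK); last exact: root_alpha.
rewrite -map_ratr_intr coprimep_map.
have [_ irr] := P_irr; rewrite /coprimep.
apply: contraT => /irr/(_ (dvdp_gcdl _ _))/eqp_size sg.
have := dvdp_leq q0 (dvdp_gcdr PQ q).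
by rewrite sg leqNgt qP.
Qed.

(** The derivative of [P] is nonzero of smaller degree, hence shares no root with [P]. *)
Lemma alpha_inj : injective alpha.
Proof.
move=> i j ij; apply/eqP; apply: contraT => nij.
have sz : (1 < size PQ)%N by rewrite size_PQ.
have sd : size (deriv PQ) = d.+1.
  apply/eqP; rewrite eqn_leq; apply/andP; split.
    by rewrite -ltnS -size_PQ lt_size_deriv // -size_poly_gt0 size_PQ.
  have : (deriv PQ)`_d != 0.
    rewrite coef_deriv (_ : PQ`_d.+1 = 1) ?pnatr_eq0 //.
    have /monicP : PQ \is monic by apply: monic_map.
    by rewrite lead_coefE size_PQ.
  by apply: contraR; rewrite -ltnNge => h; rewrite nth_default.
have := @irreducible_no_common_root (deriv PQ) i.
rewrite size_PQ sd ltnSn -size_poly_eq0 sd => /(_ isT isT).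
rewrite -deriv_map map_ratr_intr P_roots (bigD1 i) //= (bigD1 j) 1?eq_sym //=.
by rewrite derivM rootE hornerD !hornerM !hornerXsubC -ij subrr !(mul0r, mulr0, addr0) eqxx.
Qed.

(** An irreducible polynomial that vanishes at 0 is a multiple of ['X], whose only root is 0. *)
Lemma alpha_neq0 i : alpha ord0 != 0 -> alpha i != 0.
Proof.
apply: contra => /eqP i0.
have r0 : root PQ 0.
  rewrite -(fmorph_root (@ratr K)) map_ratr_intr rmorph0 -i0; exact: root_alpha.
have [_ irr] := P_irr.
have : root PK (alpha ord0) by exact: root_alpha.
have : ('X : {poly K}) %= PK.
  rewrite -map_ratr_intr -(map_polyX (@ratr K)) eqp_map.
  by apply: irr; rewrite ?size_polyX // -['X]subr0 -polyC0 dvdp_XsubCl.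
by move/eqp_root => <-; rewrite rootX.
Qed.

Let b n : K := (a n.+1)%:~R.

Lemma shift_functional_P n : shift_functional b (PK * 'X^n) = 0.
Proof.
rewrite shift_functionalMXn size_PK.
have := P_ann (ltn0Sn n); rewrite size_P => /(congr1 (intr : int -> K)).
rewrite rmorph_sum rmorph0 /= => H; rewrite -[RHS]H.
by apply: eq_bigr => i _; rewrite coef_map rmorphM /b addSn.
Qed.

(** Modulo [P], the monomial ['X^n] is its own interpolation polynomial at the roots of [P]. *)
Lemma shift_functional_lagrange n :
  b n = \sum_i shift_functional b (lagrange_poly alpha i) * alpha i ^+ n.
Proof.
have sP : (0 < size PK)%N by rewrite size_PK.
have P0 : PK != 0 by rewrite -size_poly_gt0.
rewrite -(shift_functionalXn b) {1}(divp_eq 'X^n PK) shift_functionalD.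
rewrite shift_functional_ideal ?add0r; last exact: shift_functional_P.
have sm : (size ('X^n %% PK)%R <= d.+1)%N by rewrite -ltnS -size_PK ltn_modp.
rewrite (lagrange_interpolation alpha_inj sm).
rewrite shift_functional_sum; apply: eq_bigr => i _; rewrite shift_functionalZ mulrC;
  congr (_ * _).
have := congr1 (horner^~ (alpha i)) (divp_eq 'X^n PK).
by rewrite hornerD hornerM (eqP (root_alpha i)) mulr0 add0r hornerXn.
Qed.

(** Up to a scalar the Lagrange polynomial at the root [x] is [P / ('X - x)], and
[P / ('X - x) = \sum_k P_k \sum_(j < k) x ^ (k - 1 - j) 'X^j].  Applying the functional gives the
value at [x] of the integer polynomial [H = \sum_k P_k \sum_(j < k) a_(j + 1) 'X^(k - 1 - j)], whose
degree is less than that of [P] and whose leading coefficient is [a_1]. *)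
Lemma shift_functional_dominant_neq0 : a 1%N != 0 ->
  shift_functional b (lagrange_poly alpha ord0) != 0.
Proof.
move=> a1; set x := alpha ord0.
pose Q : {poly K} := \prod_(j < d.+1 | j != ord0) ('X - (alpha j)%:P).
have QP : PK = ('X - x%:P) * Q by rewrite P_roots (bigD1 ord0).
(* The quotient of [P] by ['X - x], from the factorisation of [y ^ k - x ^ k]. *)
pose D : {poly K} := \sum_(k < d.+2) PK`_k *: \sum_(j < k) x ^+ (k.-1 - j) *: 'X^j.
have DQ : D = Q.
  apply: (@mulfI _ ('X - x%:P)); first by rewrite polyXsubC_eq0.
  rewrite -QP mulr_sumr -[RHS]coefK size_PK poly_def.
  have E k : ('X - x%:P) * (\sum_(j < k) x ^+ (k.-1 - j) *: 'X^j) = 'X^k - (x ^+ k)%:P.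
    rewrite -[LHS]opprK -mulNr opprB (eq_bigr (fun j : 'I_k => x%:P ^+ (k.-1 - j) * 'X^j)).
      by rewrite -subrXX rmorphXn opprB.
    by move=> j _; rewrite -mul_polyC rmorphXn.
  under eq_bigr do rewrite -scalerAr E scalerBr.
  rewrite sumrB (_ : \sum_(i < _) _ *: (x ^+ i)%:P = (PK.[x])%:P).
    by rewrite (eqP (root_alpha ord0)) subr0.
  rewrite horner_coef size_PK rmorph_sum; apply: eq_bigr => k _ /=.
  by rewrite -mul_polyC -polyCM.
have lQ : exists2 c, c != 0 & lagrange_poly alpha ord0 = c *: Q.
  exists (\prod_(j < d.+1 | j != ord0) (x - alpha j)^-1); last exact: scaler_prod.
  apply/prodf_neq0 => j j0; rewrite invr_eq0 subr_eq0.
  by apply: contra j0 => /eqP/alpha_inj ->.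
case: lQ => c c0 ->; rewrite shift_functionalZ mulf_neq0 // -DQ.
pose H : {poly int} := \sum_(k < d.+2) P`_k *: \sum_(j < k) a j.+1 *: 'X^(k.-1 - j).
have HD : shift_functional b D = (map_poly intr H).[x].
  rewrite shift_functional_sum rmorph_sum horner_sum; apply: eq_bigr => k _ /=.
  rewrite shift_functionalZ shift_functional_sum map_polyZ hornerZ coef_map; congr (_ * _).
  rewrite rmorph_sum horner_sum; apply: eq_bigr => j _ /=.
  by rewrite shift_functionalZ shift_functionalXn map_polyZ hornerZ map_polyXn hornerXn mulrC.
have sH : (size H <= d.+1)%N.
  apply: leq_trans (size_sum _ _ _) _; apply/bigmax_leqP => k _.
  apply: leq_trans (size_scale_leq _ _) _.
  apply: leq_trans (size_sum _ _ _) _; apply/bigmax_leqP => j _.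
  apply: leq_trans (size_scale_leq _ _) _; rewrite size_polyXn.
  by have := ltn_ord k; have := ltn_ord j; lia.
have H0 : H != 0.
  suff : H`_d != 0 by apply: contra => /eqP ->; rewrite coef0.
  rewrite coef_sum big_ord_recr /= coefZ big1 => [|k _]; last first.
    rewrite coefZ coef_sum big1 ?mulr0 // => j _; rewrite coefZ coefXn.
    case: eqP => [E|]; last by rewrite mulr0.
    by have := ltn_ord k; have := ltn_ord j; move: E; lia.
  rewrite add0r coef_sum big_ord_recl /= coefZ coefXn subn0 eqxx mulr1 big1 ?addr0.
    have -> : P`_d.+1 = 1 by have /monicP := P_monic; rewrite lead_coefE size_P.
    by rewrite mul1r.
  move=> j _; rewrite coefZ coefXn /bump /=.
  case: eqP => [E|]; last by rewrite mulr0.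
  by have := ltn_ord j; move: E; lia.
have := @irreducible_no_common_root (map_poly intr H) ord0.
rewrite map_ratr_intr rootE -/x -HD; apply.
  by rewrite -size_poly_eq0 size_map_inj_poly ?size_poly_eq0 //; exact: intr_inj.
by rewrite size_PQ size_map_inj_poly //; exact: intr_inj.
Qed.

Lemma closed_form : alpha ord0 != 0 -> a 1%N != 0 ->
  exists lambda : 'I_d.+1 -> K, lambda ord0 != 0 /\
    forall n, (0 < n)%N -> (a n)%:~R = \sum_(i < d.+1) lambda i * alpha i ^+ n.
Proof.
move=> al0 a1; exists (fun i => shift_functional b (lagrange_poly alpha i) / alpha i); split.
  by rewrite mulf_neq0 ?invr_eq0 // shift_functional_dominant_neq0.
move=> [//|n] _; rewrite -[LHS]/(b n) shift_functional_lagrange; apply: eq_bigr => i _.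
by rewrite exprS mulrA divfK // alpha_neq0.
Qed.

End ClosedForm.

(** * Decreasing tuples and the multinomial theorem *)

Section Chains.

(** The weakly decreasing [d]-tuples of natural numbers with first entry [K].  For [d = 0] the
convention that reads 0 out of bounds forces [K = 0]. *)
Fixpoint chains (d K : nat) : seq (d.-tuple nat) :=
  if d is d'.+1 then
    [seq [tuple of K :: tval t] | m <- iota 0 K.+1, t <- chains d' m]
  else if K is 0 then [:: [tuple]] else [::].

Lemma chainsS d K : chains d.+1 K =
  [seq [tuple of K :: tval t] | m <- iota 0 K.+1, t <- chains d m].
Proof. by []. Qed.

Lemma sorted_geq_cons (d : nat) (K : nat) (t : d.-tuple nat) :
  sorted geq (K :: t) = (kidx t 0 <= K)%N && sorted geq t.
Proof. by case: t => [[|m t]] //=. Qed.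

Lemma mem_chains d K (k : d.-tuple nat) :
  (k \in chains d K) = sorted geq k && (kidx k 0 == K).
Proof.
elim: d K k => [|d IH] K k.
  by rewrite (tuple0 k) /kidx /=; case: K.
case: (tupleP k) => m t; rewrite chainsS sorted_geq_cons -[kidx [tuple of m :: t] 0]/m.
apply/allpairsPdep/idP.
  move=> [x [y [xK yx /(congr1 val) /= [-> /val_inj ->]]]].
  move: yx xK; rewrite IH mem_iota /= => /andP[-> /eqP ->].
  by rewrite ltnS => ->; rewrite eqxx.
move=> /andP[/andP[tm st] /eqP <-]; exists (kidx t 0), t; split => //.
- by rewrite mem_iota /= ltnS.
- by rewrite IH st eqxx.
Qed.

Lemma uniq_chains d K : uniq (chains d K).
Proof.
elim: d K => [|d IH] K; first by case: K.
rewrite chainsS; apply: allpairs_uniq_dep => [|m _|]; [exact: iota_uniq|exact: IH|].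
move=> [m t] [m' t'] /allpairsPdep[x [y [_ + [-> E]]]] /allpairsPdep[x' [y' [_ + [-> E']]]] /=.
rewrite !mem_chains -{}E -{}E' => /andP[_ /eqP <-] /andP[_ /eqP <-].
by move=> /(congr1 val) /= [] /val_inj <-.
Qed.

Section Multinomial.
Variable F : comNzRingType.

Definition chain_exp (d : nat) (x : 'I_d -> F) (k : d.-tuple nat) : F :=
  \prod_(i < d) x i ^+ (kidx k i - kidx k i.+1).

Definition chain_binom (d : nat) (k : d.-tuple nat) : F :=
  \prod_(j < d) ('C(kidx k j, kidx k j.+1))%:R.

(** Multinomial theorem with the exponents written as the steps [k_i - k_(i + 1)] of a
decreasing tuple; the multinomial coefficient is then the product of the binomials of consecutive
entries, as in an iterated binomial theorem. *)
Lemma multinomial d K (x : 'I_d -> F) :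
  (\sum_(i < d) x i) ^+ K = \sum_(k <- chains d K) chain_binom k * chain_exp x k.
Proof.
elim: d K x => [|d IH] K x.
  rewrite big_ord0; case: K => [|K] /=; last by rewrite expr0n big_nil.
  by rewrite big_seq1 /chain_binom /chain_exp !big_ord0 mulr1 expr0.
rewrite big_ord_recl exprDn chainsS big_allpairs_dep.
rewrite -(big_mkord xpredT
  (fun m => x ord0 ^+ (K - m) * (\sum_(i < d) x (lift ord0 i)) ^+ m *+ 'C(K, m))).
rewrite /index_iota subn0.
apply: eq_bigr => m _; rewrite IH mulr_sumr -sumrMnl.
rewrite big_seq [RHS]big_seq; apply: eq_bigr => t.
rewrite mem_chains => /andP[_ /eqP tm].
rewrite /chain_binom /chain_exp !big_ord_recl /= -[kidx _ 1]/(kidx t 0) tm.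
rewrite -[kidx _ 0]/K -mulr_natl; set p := \prod_(i < d) _; set q := \prod_(i < d) _.
by rewrite -[X in _ = _ * X * _]/p -[X in _ = _ * (_ * X)]/q; ring.
Qed.

End Multinomial.

(** Telescoping, with last entry 0. *)
Lemma sum_chain_steps d (k : d.-tuple nat) : sorted geq k ->
  (\sum_(i < d) (kidx k i - kidx k i.+1) = kidx k 0)%N.
Proof.
elim: d k => [|d IH] k; first by rewrite big_ord0 (tuple0 k).
case: (tupleP k) => m t; rewrite sorted_geq_cons => /andP[tm st].
rewrite big_ord_recl -[kidx _ 0]/m -[kidx _ (ord0 : 'I_d.+1).+1]/(kidx t 0).
have -> : (\sum_(i < d) (kidx [tuple of m :: t] (lift ord0 i) -
    kidx [tuple of m :: t] (lift ord0 i).+1) = kidx t 0)%N by exact: IH.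
by rewrite subnK.
Qed.

End Chains.

(** * Arguments and the points of the family *)

Section Argument.
Variable R : realType.
Implicit Types (u w s z : R[i]) (x y l : R).

(** [carg w] is the angle of [w]: the two cases of its definition match the sign of the imaginary
part, since [sin (acos x)] is the nonnegative root. *)
Lemma cexp_polar w : w != 0 -> cexp (ln (cmod w) +i* carg w) = w.
Proof.
move=> w0; have c0 : 0 < cmod w by rewrite cmod_gt0.
have r1 : -1 <= complex.Re w / cmod w <= 1.
  rewrite -ler_norml normrM normfV (ger0_norm (cmod_ge0 _)) ler_pdivrMr // mul1r.
  exact: Re_le_cmod.
have sq : 1 - (complex.Re w / cmod w) ^+ 2 = (complex.Im w / cmod w) ^+ 2.
  have cm : cmod w ^+ 2 = complex.Re w ^+ 2 + complex.Im w ^+ 2.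
    by rewrite cmodE sqr_sqrtr // addr_ge0 ?sqr_ge0.
  apply: (mulIf (lt0r_neq0 (exprn_gt0 2 c0))).
  rewrite mulrBl mul1r -!exprMn !divfK ?gt_eqF // cm; ring.
have e : expR (ln (cmod w)) = cmod w by rewrite lnK // posrE.
rewrite /cexp /= e /carg; apply: complex_ext => /=; case: ifPn => i0.
- by rewrite acosK ?in_itv //= mulrCA divff ?mulr1 ?gt_eqF.
- by rewrite cosN acosK ?in_itv //= mulrCA divff ?mulr1 ?gt_eqF.
- rewrite sin_acos // sq sqrtr_sqr ger0_norm ?divr_ge0 ?cmod_ge0 //.
  by rewrite mulrCA divff ?mulr1 ?gt_eqF.
- rewrite sinN sin_acos // sq sqrtr_sqr ler0_norm ?opprK.
    by rewrite mulrCA divff ?mulr1 ?gt_eqF.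
  by rewrite pmulr_lle0 ?invr_gt0 // ltW // ltNge.
Qed.

(** Reduce [y] modulo [2 pi]; on the second half of the period use that cosine is even. *)
Lemma cos_eq1 y : cos y = 1 -> exists n : int, y = 2 * pi * n%:~R.
Proof.
move=> cy; have p0 : 0 < 2 * pi :> R by rewrite mulr_gt0 ?pi_gt0.
have per x (n : int) : cos (x + 2 * pi * n%:~R) = cos x.
  have pn t (m : nat) : cos (t + 2 * pi * m%:R) = cos t :> R.
    rewrite -[RHS](periodicn (@cosD2pi R) m); congr (cos (_ + _)).
    by rewrite -[in RHS]mulr_natr -[pi *+ 2]mulr_natr (mulrC 2).
  case: n => n; first exact: pn.
  rewrite NegzE -[LHS](pn _ n.+1) rmorphN /= -pmulrn; congr cos; ring.
pose n := Num.floor (y / (2 * pi)).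
have /andP[n1 n2] := floor_itv (y / (2 * pi)).
exists n; pose t := y + 2 * pi * (- n)%:~R.
have ct : cos t = 1 by rewrite /t per.
have t0 : 0 <= t.
  by rewrite /t rmorphN mulrN subr_ge0 mulrC -ler_pdivlMr.
have t2 : t < 2 * pi.
  move: n2; rewrite ltr_pdivrMr // -/n rmorphD /= mulrDl mul1r => n2.
  by rewrite /t rmorphN mulrN ltrBlDl mulrC.
suff -> : y = t + 2 * pi * n%:~R.
  suff -> : t = 0 by rewrite add0r.
  have p1 := pi_gt0 R.
  have [tp|tp] := leP t pi.
    by apply: cos_inj; rewrite ?in_itv /= ?t0 ?tp ?lexx ?ltW // ct cos0.
  suff /eqP : 2 * pi - t = 0 by rewrite subr_eq0 => /eqP E; move: t2; rewrite E ltxx.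
  (* The reflected angle lies in the interval where cosine is injective. *)
  have t3 : 0 <= 2 * pi - t <= pi.
    by apply/andP; split; [rewrite subr_ge0 ltW|move: tp; lra].
  apply: cos_inj; rewrite ?in_itv /= ?lexx ?(ltW p1) // cos0.
  transitivity (cos (t + 2 * pi * (-1)%:~R)); last by rewrite per ct.
  by rewrite -cosN; congr cos; rewrite rmorphN1; ring.
by rewrite /t rmorphN mulrN subrK.
Qed.

Lemma cexp_eq1 u : cexp u = 1 -> exists n : int, u = 0 +i* (2 * pi * n%:~R).
Proof.
move=> u1; have : expR (complex.Re u) = 1 by rewrite -cmod_cexp u1 cmod1.
rewrite -expR0 => /expR_inj r0.
have := congr1 (@complex.Re R) u1; rewrite /cexp /= r0 expR0 mul1r => /cos_eq1[n i0].
by exists n; apply: complex_ext.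
Qed.

Lemma cexp_2pi (n : int) : cexp (0 +i* (2 * pi * n%:~R)) = 1 :> R[i].
Proof.
have e m : cexp (0 +i* (2 * pi * m%:R)) = 1 :> R[i].
  rewrite (_ : _ +i* _ = m%:R * (0 +i* (2 * pi))).
    rewrite cexpM_nat /cexp /= expR0 !mul1r mulr_natl cos2pi sin2pi.
    by rewrite -[_ +i* _]/(1 : R[i]) expr1n.
  rewrite -(rmorph_nat (real_complex R) m).
  by apply: complex_ext; rewrite /= ?mulr0 ?mul0r ?subr0 ?addr0 // mulrC.
case: n => n; first exact: e.
rewrite NegzE rmorphN /= -pmulrn (_ : _ +i* _ = - (0 +i* (2 * pi * n.+1%:R))).
  by rewrite cexpN e invr1.
by apply: complex_ext; rewrite /= ?oppr0 // mulrN.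
Qed.

Variables (d : nat) (alpha : 'I_d.+1 -> R[i]) (z : R[i]).
Hypothesis alpha_neq0 : forall i, alpha i != 0.
Hypothesis alpha0_real : alpha ord0 = (complex.Re (alpha ord0))%:C.
Hypothesis alpha0_gt1 : 1 < complex.Re (alpha ord0).
Hypothesis z_neq0 : z != 0.

(** For a decreasing tuple [k] this is the product of the ratios [alpha_i / alpha_1] with
exponents the steps of [k] ([ratio_chain_exp]). *)
Definition ratio (k : d.-tuple nat) : R[i] := alpha ord0 ^- (kidx k 0) * root_prod alpha k.

Lemma log_dominant_gt0 : 0 < log_dominant alpha.
Proof. by rewrite /log_dominant ln_gt0. Qed.

Lemma root_prod_neq0 k : root_prod alpha k != 0.
Proof. by apply/prodf_neq0 => i _; rewrite expf_neq0. Qed.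

Lemma cexp_lerch_point n k :
  cexp (lerch_point alpha z n k * (log_dominant alpha)%:C) = z * ratio k.
Proof.
have l0 := lt0r_neq0 log_dominant_gt0; have rp0 := root_prod_neq0 k.
set l := log_dominant alpha in l0 *.
have pi0 : pi != 0 :> R by rewrite gt_eqF ?pi_gt0.
pose b := complex.Re (alpha ord0) ^- kidx k 0.
have b0 : 0 < b by rewrite invr_gt0 exprn_gt0 // (lt_trans ltr01).
have aE : alpha ord0 ^- kidx k 0 = b%:C.
  by rewrite alpha0_real -rmorphXn -fmorphV.
rewrite (_ : _ * _ = (ln (cmod z) +i* carg z) +
    (ln (cmod (root_prod alpha k)) +i* carg (root_prod alpha k)) +
    (ln b)%:C + (0 +i* (2 * pi * n%:~R))); last first.
  rewrite /lerch_point /base_point /abscissa -/l aE cmodM cmod_real (gtr0_norm b0).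
  rewrite lnM ?posrE ?cmod_gt0 //.
  apply: complex_ext; rewrite /= ?addr0 ?mulr0 ?subr0 ?add0r; first by field; rewrite l0.
  by rewrite [2 * pi * (carg z / _)]mulrC divfK ?mulf_neq0 ?pnatr_eq0 //; field.
rewrite !cexpD cexp_2pi mulr1 cexp_real lnK ?posrE // !cexp_polar //.
by rewrite -aE /ratio -mulrA; congr (_ * _); rewrite mulrC.
Qed.

(** The points attached to the tuple [k] are the solutions of [z e ^ (- l s) * ratio k = 1]; the
integer [n] enumerates the branches of the logarithm. *)
Lemma lerch_pointP s k :
  (exists n : int, s = lerch_point alpha z n k) <->
  z * cexp (- s * (log_dominant alpha)%:C) * ratio k = 1.
Proof.
set l := (log_dominant alpha)%:C.
have l0 : l != 0 by rewrite (fmorph_eq0 (real_complex R)) gt_eqF // log_dominant_gt0.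
have zr0 : z * ratio k != 0.
  by rewrite mulf_neq0 // mulf_neq0 ?root_prod_neq0 // invr_eq0 expf_neq0.
split=> [[n ->]|].
  by rewrite mulrAC -(cexp_lerch_point n) -cexpD mulNr subrr cexp0.
rewrite mulrAC => E.
have : cexp (lerch_point alpha z 0 k * l + - s * l) = 1.
  by rewrite cexpD cexp_lerch_point.
move=> /cexp_eq1[n nE]; exists (- n).
have E2 : (lerch_point alpha z 0 k - lerch_point alpha z (- n) k) * l = 0 +i* (2 * pi * n%:~R).
  have -> : lerch_point alpha z 0 k - lerch_point alpha z (- n) k =
      0 +i* (2 * pi * n%:~R / log_dominant alpha).
    rewrite /lerch_point opprD addrACA subrr add0r /base_point.
    apply: complex_ext; rewrite /= ?subrr // -mulrBl; congr (_ / _).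
    by rewrite rmorphN /=; ring.
  apply: complex_ext; rewrite /= ?mul0r ?mulr0 ?subr0 ?add0r //.
  by rewrite divfK // lt0r_neq0 ?log_dominant_gt0.
apply/eqP; rewrite -subr_eq0 -(mulIr_eq0 _ (mulIf l0)); apply/eqP.
rewrite (_ : (s - _) * l = - (lerch_point alpha z 0 k * l + - s * l) +
  (lerch_point alpha z 0 k - lerch_point alpha z (- n) k) * l); last by ring.
by rewrite nE E2 addNr.
Qed.

End Argument.

(** * Holomorphic functions *)

Section Holomorphic.
Variable R : realType.
Implicit Types (s t h w c : R[i]) (l rho : R) (f g : R[i]^o -> R[i]^o).

Lemma holomorphic_at_near f s : holomorphic_at f s ->
  \forall t \near (s : R[i]^o), holomorphic_at f t.
Proof. exact: near_join. Qed.

Lemma eq_holomorphic_at f g s : (\forall t \near (s : R[i]^o), f t = g t) ->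
  holomorphic_at f s -> holomorphic_at g s.
Proof.
move=> /near_join fg; rewrite /holomorphic_at; move: fg; apply: filterS2 => t.
exact: near_eq_derivable.
Qed.

Lemma entire_holomorphic f s : (forall t, derivable f t 1) -> holomorphic_at f s.
Proof. by move=> H; apply/nearE_cmod; exists 1. Qed.

Lemma holomorphic_at_cst c s : holomorphic_at (fun=> c) s.
Proof. by apply: entire_holomorphic => t; exact: derivable_cst. Qed.

Lemma holomorphic_at_id s : holomorphic_at id s.
Proof. by apply: entire_holomorphic => t; exact: derivable_id. Qed.

Lemma holomorphic_atD f g s : holomorphic_at f s -> holomorphic_at g s ->
  holomorphic_at (fun t => f t + g t) s.
Proof. by apply: filterS2 => t ft gt; exact: derivableD. Qed.

Lemma holomorphic_atM f g s : holomorphic_at f s -> holomorphic_at g s ->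
  holomorphic_at (fun t => f t * g t) s.
Proof.
apply: filterS2 => t ft gt.
exact: (@derivableM R[i] R[i]^o f g t 1 ft gt).
Qed.

Lemma holomorphic_atB f g s : holomorphic_at f s -> holomorphic_at g s ->
  holomorphic_at (fun t => f t - g t) s.
Proof. by apply: filterS2 => t ft gt; exact: derivableB. Qed.

Lemma holomorphic_continuous f s : holomorphic_at f s -> {for (s : R[i]^o), continuous f}.
Proof. by move=> /holomorphic_derivable/derivable_continuous_at. Qed.

Lemma near_neq f s c : {for (s : R[i]^o), continuous f} -> f s != c ->
  \forall t \near (s : R[i]^o), f t != c.
Proof.
move=> /cvg_cmod H fc.
have e0 : 0 < cmod (f s - c) by rewrite cmod_gt0 subr_eq0.
move: (H _ e0); apply: filterS => t; apply: contraTneq => ->.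
by rewrite -leNgt cmodC.
Qed.

Lemma holomorphic_atV f s : holomorphic_at f s -> f s != 0 ->
  holomorphic_at (fun t => (f t)^-1) s.
Proof.
move=> hf fs; have := near_neq (holomorphic_continuous hf) fs.
by move: hf; apply: filterS2 => t ft f0; exact: derivableV.
Qed.

Lemma holomorphic_at_sum I (r : seq I) (P : pred I) (f : I -> R[i]^o -> R[i]^o) s :
  (forall i, P i -> holomorphic_at (f i) s) ->
  holomorphic_at (fun t => \sum_(i <- r | P i) f i t) s.
Proof.
move=> H; elim: r => [|i r IH].
  rewrite (_ : (fun t => _) = fun=> 0); first exact: holomorphic_at_cst.
  by apply/funext => t; rewrite big_nil.
have [Pi|Pi] := boolP (P i).
  rewrite (_ : (fun t => _) = fun t => f i t + \sum_(j <- r | P j) f j t).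
    exact: (holomorphic_atD (H _ Pi) IH).
  by apply/funext => t; rewrite big_cons Pi.
rewrite (_ : (fun t => _) = fun t => \sum_(j <- r | P j) f j t) //.
by apply/funext => t; rewrite big_cons (negPf Pi).
Qed.

Lemma holomorphic_at_horner (p : {poly R[i]}) s : holomorphic_at (horner p) s.
Proof.
apply: entire_holomorphic => t; have [M HM] := quad_approx_poly p t (lexx 1).
exact: quad_approx_derivable ltr01 HM.
Qed.

Lemma holomorphic_at_cexp c s : holomorphic_at (fun t => cexp (t * c)) s.
Proof.
apply: entire_holomorphic => t.
apply: (@derivable_quad _ _ _ (c * cexp (t * c))
  (4 * cmod c ^+ 2 * expR (cmod (t * c) + cmod c)) 1) => // h h1.
have tail0 u : exp_tail 0 u = cexp u :> R[i] by rewrite /exp_tail big_ord0 subr0.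
have B : cmod (t * c) + cmod (h * c) <= cmod (t * c) + cmod c.
  by rewrite lerD2l cmodM ler_piMl ?cmod_ge0.
have := exp_tail_quad 0 B; rewrite /= !tail0 expr0 mul1r -mulrDl -mulrA => H.
apply: le_trans H _; rewrite cmodM exprMn mulrA le_eqVlt; apply/orP; left; apply/eqP; ring.
Qed.

(** The entire function [(1 - e ^ (- l h)) / h], with its value at the removable singularity. *)
Definition exp_quotient l (h : R[i]) : R[i] :=
  if h == 0 then l%:C else (1 - cexp (h * - l%:C)) / h.

(** At [h = 0] the second-order error is the Taylor remainder of order 3 divided by [h]. *)
Lemma holomorphic_at_exp_quotient l s : holomorphic_at (exp_quotient l) s.
Proof.
apply: entire_holomorphic => t; have [->|t0] := eqVneq t 0; last first.
  have hq : holomorphic_at (fun h => (1 - cexp (h * - l%:C)) / h) t.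
    apply: holomorphic_atM; last exact: (holomorphic_atV (holomorphic_at_id t) t0).
    exact: (holomorphic_atB (holomorphic_at_cst 1 t) (holomorphic_at_cexp (- l%:C) t)).
  have tn0 : \forall h \near (t : R[i]^o), h != 0.
    by apply: near_neq (holomorphic_continuous (holomorphic_at_id _)) _.
  have := holomorphic_derivable hq; apply: near_eq_derivable.
  by move: tn0; apply: filterS => h h0; rewrite /exp_quotient (negPf h0).
pose M := 8 * `|l| ^+ 3 * expR `|l|.
apply: (@derivable_quad _ _ _ (- (l%:C ^+ 2 / 2)) M 1) => // h h1.
rewrite add0r; have [->|h0] := eqVneq h 0.
  by rewrite subrr mul0r subrr cmod0 expr0n mulr0.
rewrite /exp_quotient eqxx (negPf h0).
have -> : (1 - cexp (h * - l%:C)) / h - l%:C - h * - (l%:C ^+ 2 / 2) =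
  - exp_tail 3 (h * - l%:C) / h.
  rewrite /exp_tail !big_ord_recr big_ord0 /= fact0 !factS fact0 !muln1 expr0 expr1 add0r.
  by field.
have ch : 0 < cmod h by rewrite cmod_gt0.
rewrite cmodM cmodN cmodV ler_pdivrMr //.
apply: le_trans (exp_tail_le _ _) _; rewrite cmodM cmodN cmod_real.
rewrite (_ : M * _ * _ = (2 * (cmod h * `|l|)) ^+ 3 * expR `|l|); last by rewrite /M; ring.
rewrite ler_wpM2l ?exprn_ge0 ?mulr_ge0 ?(ltW ch) // ler_expR ler_piMl //.
Qed.

End Holomorphic.

(** * Continuation of a perturbed geometric series *)

Section SeriesMore.
Variable R : realType.
Implicit Types (x w : R[i]).

Lemma csum_bigsum I (r : seq I) (u : I -> nat -> R[i]) (a : I -> R[i]) :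
  (forall i, List.In i r -> series (u i : nat -> R[i]^o) @ \oo --> (a i : R[i]^o)) ->
  series ((fun n => \sum_(i <- r) u i n) : nat -> R[i]^o) @ \oo -->
     (\sum_(i <- r) a i : R[i]^o).
Proof.
elim: r => [|i r IH] H.
  rewrite big_nil (_ : series _ = fun=> 0); first exact: cvg_cst.
  by apply/funext => n; rewrite seriesE big1 // => k _; rewrite big_nil.
rewrite big_cons (_ : (fun n => _) = (fun n => u i n + \sum_(j <- r) u j n)); last first.
  by apply/funext => n; rewrite big_cons.
by apply: csumD; [apply: H; left|apply: IH => j jr; apply: H; right].
Qed.

(** The sum of the geometric series with first term [x]: the series over [a_n] starts at
[n = 1]. *)
Definition geometric_sum x : R[i] := x / (1 - x).

Lemma csum_geometric_sum x : cmod x < 1 ->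
  series ((fun n => x ^+ n.+1) : nat -> R[i]^o) @ \oo --> (geometric_sum x : R[i]^o).
Proof.
move=> x1; rewrite (_ : (fun n => _) = (fun n => x * x ^+ n)).
  exact: (csumZ (csum_geometric x1)).
by apply/funext => n; rewrite exprS.
Qed.

Lemma derivable_shift (f : R[i]^o -> R[i]^o) (c s : R[i]) :
  derivable f (s - c) 1 -> derivable (fun t : R[i]^o => f (t - c)) s 1.
Proof.
rewrite /derivable.
rewrite (_ : (fun h : R[i] => h^-1 *: ((f \o shift (s - c)) (h *: 1) - f (s - c)) : R[i]^o) =
  (fun h : R[i] =>
     h^-1 *: (((fun t : R[i]^o => f (t - c)) \o shift s) (h *: 1) - f (s - c)) : R[i]^o)) //.
by apply/funext => h /=; rewrite addrA.
Qed.

End SeriesMore.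

Section Continuation.
Variables (R : realType) (l rho : R) (z : R[i]) (eps : nat -> R) (C1 : R).
Variables (T : eqType) (idx : nat -> seq T) (c beta : T -> R[i]) (deg : T -> nat).
Hypothesis l_gt0 : 0 < l.
Hypothesis rho01 : 0 < rho < 1.
Hypothesis eps_gtN1 : forall n, -1 < eps n.
Hypothesis ln_eps : forall n, `|ln (1 + eps n)| <= C1 * rho ^+ n.
Hypothesis deg_idx : forall k i, i \in idx k -> deg i = k.
Hypothesis beta_le : forall k i, i \in idx k -> cmod (beta i) <= rho ^+ k.
(* The sequences are indexed from 1 and [eps] from 0, whence the exponent [n.+1]. *)
Hypothesis epsX : forall k n,
  (eps n)%:C ^+ k = \sum_(i <- idx k) c i * beta i ^+ n.+1.

Implicit Types (s t : R[i]).

Let w t : R[i] := z * cexp (- t * l%:C).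

(** The condition amounts to a lower bound on the real part of [t], which tends to minus infinity
as [K] grows. *)
Definition half_plane K t := cmod (w t) * rho ^+ K < 1.
Definition remainder_term K n : R[i]^o -> R[i]^o := fun t => w t ^+ n.+1 * binom_rem K t (eps n).
Definition remainder_sum K t : R[i] := csum (fun n => remainder_term K n t).

Let rho_gt0 : 0 < rho. Proof. by case/andP: rho01. Qed.
Let rho_lt1 : rho < 1. Proof. by case/andP: rho01. Qed.
Let rX k : 0 < rho ^+ k. Proof. by rewrite exprn_gt0. Qed.

Lemma holomorphic_at_w s : holomorphic_at w s.
Proof.
rewrite (_ : w = fun t => z * cexp (t * - l%:C)).
  exact: (holomorphic_atM (holomorphic_at_cst z s) (holomorphic_at_cexp (- l%:C) s)).
by apply/funext => t; rewrite /w mulNr mulrN.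
Qed.

Lemma half_plane_near K s : half_plane K s -> \forall t \near (s : R[i]^o), half_plane K t.
Proof.
rewrite /half_plane -ltr_pdivlMr // mul1r => ds.
have e0 : 0 < (rho ^+ K)^-1 - cmod (w s) by rewrite subr_gt0.
have /cvg_cmod/(_ _ e0) := holomorphic_continuous (holomorphic_at_w s).
apply: filterS => t H; rewrite -ltr_pdivlMr // mul1r.
rewrite -[w t](subrK (w s)); apply: le_lt_trans (cmodD _ _) _.
by rewrite -ltrBrDr.
Qed.

Lemma half_planeW K K' t : (K <= K')%N -> half_plane K t -> half_plane K' t.
Proof.
move=> KK'; apply: le_lt_trans; rewrite ler_wpM2l ?cmod_ge0 //.
by rewrite ler_wiXn2l // ltW.
Qed.

Lemma half_plane_exists t : exists K, half_plane K t.
Proof.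
have : geometric (cmod (w t)) rho @ \oo --> 0.
  by apply: cvg_geometric; rewrite gtr0_norm.
move=> /cvgrPdist_lt/(_ _ ltr01)[K _ /(_ K (leqnn K))] /=.
rewrite sub0r normrN ger0_norm ?mulr_ge0 ?cmod_ge0 ?(ltW (rX K)) // => HK.
by exists K.
Qed.

Lemma C1_ge0 : 0 <= C1.
Proof. by have := le_trans (normr_ge0 _) (ln_eps 0); rewrite expr0 mulr1. Qed.

(** Any [r1] strictly between [|w s|] and [rho ^ (- K)] serves as the rate for the powers of
[w]; the binomial remainders contribute [rho ^ (n K)]. *)
Lemma quad_approx_remainder_term K s : half_plane K s -> exists rad r C,
  [/\ 0 < rad <= 1, 0 <= r < 1 & forall n, quad_approx (remainder_term K n) s rad (C * r ^+ n)].
Proof.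
rewrite /half_plane -ltr_pdivlMr // mul1r => ds.
(* The midpoint of the interval of admissible rates. *)
pose r1 := (cmod (w s) + (rho ^+ K)^-1) / 2.
have [wr1 r1K] : cmod (w s) < r1 /\ r1 < (rho ^+ K)^-1 by rewrite /r1; split; lra.
have r10 : 0 < r1 := le_lt_trans (cmod_ge0 _) wr1.
have [rad [C [rad0 rad1 C0 HC]]] := quad_approx_exp_power l_gt0 wr1.
have [C' C'0 HC'] := quad_approx_binom_rem K s C1 rad1.
exists rad, (r1 * rho ^+ K), (6 * (C * r1) * (C' * C1 ^+ K)); split.
- by rewrite rad0.
- by rewrite mulr_ge0 ?(ltW r10) ?(ltW (rX K)) //= -ltr_pdivlMr // mul1r.
move=> n; have q1 := HC n.+1; have q2 :
    quad_approx (fun t => binom_rem K t (eps n)) s rad (C' * (C1 * rho ^+ n) ^+ K).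
  apply: quad_approxW (HC' _ (eps_gtN1 n) _).
    by rewrite ler_wpM2l // lerXn2r ?nnegrE ?normr_ge0 // mulr_ge0 ?C1_ge0 // ltW.
  by apply: le_trans (ln_eps n) _; rewrite ler_piMr ?C1_ge0 // exprn_ile1 // ltW.
have := quad_approxM rad1 q1 q2.
rewrite (_ : 6 * _ * _ = 6 * (C * r1) * (C' * C1 ^+ K) * (r1 * rho ^+ K) ^+ n) //.
rewrite exprS [(C1 * _) ^+ K]exprMn [(r1 * _) ^+ n]exprMn.
rewrite -[(rho ^+ n) ^+ K]exprM -[(rho ^+ K) ^+ n]exprM (mulnC K).
by ring.
Qed.

Lemma remainder_sum_cvg K s : half_plane K s ->
  series ((fun n => remainder_term K n s) : nat -> R[i]^o) @ \oo --> (remainder_sum K s : R[i]^o).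
Proof.
move=> /quad_approx_remainder_term[rad [r [C [rad01 r01 H]]]].
have [+ _] := quad_approx_csum rad01 r01 H; apply.
by rewrite subrr cmod0 ltW //; case/andP: rad01.
Qed.

Lemma remainder_sum_derivable K s : half_plane K s ->
  derivable (remainder_sum K : R[i]^o -> R[i]^o) s 1.
Proof.
move=> /quad_approx_remainder_term[rad [r [C [rad01 r01 H]]]].
have [_ +] := quad_approx_csum rad01 r01 H; apply: quad_approx_derivable.
by case/andP: rad01.
Qed.

Lemma holomorphic_at_remainder_sum K s : half_plane K s ->
  holomorphic_at (remainder_sum K : R[i]^o -> R[i]^o) s.
Proof. by move=> /half_plane_near; apply: filterS => t; exact: remainder_sum_derivable. Qed.

Definition below K : seq T := \big[cat/[::]]_(k < K) idx k.

(** The contribution of the orders below [K], after summation over [n]. *)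
Definition polar_terms K t : R[i] :=
  \sum_(i <- below K) cbinom (- t) (deg i) * c i * geometric_sum (w t * beta i).

Definition partial_continuation K t : R[i] := polar_terms K t + remainder_sum K t.

Lemma below_recr K : below K.+1 = below K ++ idx K.
Proof. by rewrite /below big_ord_recr. Qed.

(** On the half plane of order [K] the geometric series that make up the term of order [K]
converge, because their ratios [beta i] are at most [rho ^ K] in modulus. *)
Lemma partial_continuation_step K t : half_plane K t ->
  partial_continuation K.+1 t = partial_continuation K t.
Proof.
move=> dK; rewrite /partial_continuation /polar_terms below_recr big_cat /= -addrA; congr (_ + _).
symmetry; apply: csumP.
rewrite (_ : (fun n => _) = (fun n =>
  \sum_(i <- idx K) cbinom (- t) K * c i * (w t * beta i) ^+ n.+1 + remainder_term K.+1 n t));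
    last first.
  apply/funext => n; rewrite /remainder_term /binom_rem [in RHS]big_ord_recr /= epsX.
  have -> : \sum_(i <- idx K) cbinom (- t) K * c i * (w t * beta i) ^+ n.+1 =
      w t ^+ n.+1 * (cbinom (- t) K * \sum_(i <- idx K) c i * beta i ^+ n.+1).
    by rewrite 2!mulr_sumr; apply: eq_bigr => i _; rewrite exprMn; ring.
  by rewrite -mulrDr; congr (_ * _); rewrite [RHS]addrC opprD addrA subrK.
apply: csumD; last exact/remainder_sum_cvg/half_planeW/dK.
have -> : \sum_(i <- idx K) cbinom (- t) (deg i) * c i * geometric_sum (w t * beta i) =
    \sum_(i <- idx K) cbinom (- t) K * c i * geometric_sum (w t * beta i).
  by rewrite big_seq [RHS]big_seq; apply: eq_bigr => i /deg_idx ->.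
apply: csum_bigsum => i iK.
have {}iK : i \in idx K.
  by elim: (idx K) iK => //= j r IH [->|/IH]; rewrite inE ?eqxx // => ->; rewrite orbT.
apply: csumZ; apply: csum_geometric_sum; rewrite cmodM; apply: le_lt_trans dK.
by rewrite ler_wpM2l ?cmod_ge0 // beta_le.
Qed.

Lemma partial_continuation_le K K' t : (K <= K')%N -> half_plane K t ->
  partial_continuation K' t = partial_continuation K t.
Proof.
move=> + dK; elim: K' => [|K' IH]; first by rewrite leqn0 => /eqP ->.
rewrite leq_eqVlt => /predU1P[->//|]; rewrite ltnS => KK'.
by rewrite partial_continuation_step ?IH //; exact: half_planeW dK.
Qed.

(** Any admissible [K] gives the same value; [xget] picks one. *)
Definition continuation t : R[i] := partial_continuation (xget 0%N [set K | half_plane K t]) t.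

Lemma continuationE K t : half_plane K t -> continuation t = partial_continuation K t.
Proof.
move=> dK; rewrite /continuation; case: xgetP => [K' _ dK'|]; last by move=> /(_ K).
have [KK'|K'K] := leqP K K'; first exact: partial_continuation_le.
by symmetry; apply: partial_continuation_le => //; exact: ltnW.
Qed.

Lemma continuation_series s : cmod (w s) < 1 ->
  series ((fun n => w s ^+ n.+1 * cexp (- s * (ln (1 + eps n))%:C)) : nat -> R[i]^o) @ \oo -->
    (continuation s : R[i]^o).
Proof.
move=> ws; have d0 : half_plane 0 s by rewrite /half_plane expr0 mulr1.
rewrite (continuationE d0) /partial_continuation /polar_terms /below big_ord0 big_nil add0r.
have := remainder_sum_cvg d0; rewrite /remainder_term /binom_rem.
by rewrite (_ : (fun n => _) = (fun n => w s ^+ n.+1 * cexp (- s * (ln (1 + eps n))%:C))) //;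
  apply/funext => n; rewrite big_ord0 subr0.
Qed.

Lemma continuation_holomorphic s : cmod (w s) < 1 ->
  holomorphic_at (continuation : R[i]^o -> R[i]^o) s.
Proof.
move=> ws; have d0 : half_plane 0 s by rewrite /half_plane expr0 mulr1.
apply: eq_holomorphic_at (holomorphic_at_remainder_sum d0).
move: (half_plane_near d0); apply: filterS => t dt.
by rewrite (continuationE dt) /partial_continuation /polar_terms /below big_ord0 big_nil add0r.
Qed.

Definition local_polar_sum K s : R[i] :=
  \sum_(i <- below K | w s * beta i == 1) cbinom (- s) (deg i) * c i.

(** Let [p] be the sum of the coefficients of the summands that are singular at [s], a polynomial
in [t].  They all have the same ratio [beta i = 1 / w s], so their sum is
[p.[t] * e / (1 - e)] with [e = e ^ (- l (t - s))], and [e / (1 - e) = A t / (t - s)] where [A] is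
holomorphic at [s] with [A s = 1 / l]. *)
Lemma continuation_local K s : half_plane K s ->
  exists G : R[i]^o -> R[i]^o,
    [/\ holomorphic_at G s, G s = l%:C^-1 * local_polar_sum K s,
       \forall t \near (s : R[i]^o)^', continuation t = G t / (t - s) &
       local_polar_sum K s = 0 -> exists2 H : R[i]^o -> R[i]^o, holomorphic_at H s &
         \forall t \near (s : R[i]^o)^', continuation t = H t].
Proof.
move=> dK.
pose p : {poly R[i]} := \sum_(i <- below K | w s * beta i == 1)
  c i *: (cbinom_poly R (deg i) \Po (- 'X)).
have pE t : p.[t] = \sum_(i <- below K | w s * beta i == 1) cbinom (- t) (deg i) * c i.
  rewrite /p horner_sum; apply: eq_bigr => i _.
  by rewrite hornerZ horner_comp hornerN hornerX horner_cbinom_poly mulrC.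
(* The summands that are regular at [s]. *)
pose rest (t : R[i]^o) : R[i]^o := \sum_(i <- below K | w s * beta i != 1)
  cbinom (- t) (deg i) * c i * geometric_sum (w t * beta i).
have hrest : holomorphic_at rest s.
  apply: holomorphic_at_sum => i si.
  have hw : holomorphic_at (fun t : R[i]^o => w t * beta i : R[i]^o) s.
    exact: (holomorphic_atM (holomorphic_at_w s) (holomorphic_at_cst (beta i) s)).
  apply: holomorphic_atM.
    apply: (@holomorphic_atM _ (fun t => cbinom (- t) (deg i))); last exact: holomorphic_at_cst.
    rewrite (_ : (fun t => _) = horner (cbinom_poly R (deg i) \Po (- 'X))).
      exact: holomorphic_at_horner.
    by apply/funext => t; rewrite horner_comp hornerN hornerX horner_cbinom_poly.
  apply: (holomorphic_atM hw); apply: holomorphic_atV.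
    exact: (holomorphic_atB (holomorphic_at_cst 1 s) hw).
  by rewrite subr_eq0 eq_sym.
pose A (t : R[i]^o) : R[i]^o := cexp ((t - s) * - l%:C) / exp_quotient l (t - s).
have lC0 : l%:C != 0 :> R[i] by rewrite (fmorph_eq0 (real_complex R)) gt_eqF.
have hA : holomorphic_at A s.
  apply: holomorphic_atM.
    apply: entire_holomorphic => t.
    apply: (@derivable_shift _ (fun t => cexp (t * - l%:C))).
    exact/holomorphic_derivable/holomorphic_at_cexp.
  apply: (@holomorphic_atV _ (fun t => exp_quotient l (t - s))).
    apply: entire_holomorphic => t; apply: derivable_shift.
    exact/holomorphic_derivable/holomorphic_at_exp_quotient.
  by rewrite subrr /exp_quotient eqxx.
have As : A s = l%:C^-1.
  by rewrite /A subrr mul0r cexp0 /exp_quotient eqxx mul1r.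
have htail := holomorphic_at_remainder_sum dK.
have hts : holomorphic_at (fun t : R[i]^o => t - s : R[i]^o) s.
  exact: (holomorphic_atB (holomorphic_at_id s) (holomorphic_at_cst s s)).
have near_eq : \forall t \near (s : R[i]^o)^',
    continuation t = p.[t] * A t / (t - s) + (rest t + remainder_sum K t).
  have /nearE_cmod[e e0 He] := half_plane_near dK; apply/dnearE_cmod; exists e => // t ts tns.
  rewrite (continuationE (He _ ts)) /partial_continuation addrA; congr (_ + _).
  rewrite /polar_terms (bigID (fun i => w s * beta i == 1)) /=; congr (_ + _).
  have ts0 : t - s != 0 by rewrite subr_eq0.
  rewrite pE mulr_suml mulr_suml; apply: eq_bigr => i /eqP si; rewrite -[RHS]mulrA; congr (_ * _).
  rewrite /A /exp_quotient (negPf ts0) invf_div /geometric_sum.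
  have -> : w t * beta i = cexp ((t - s) * - l%:C).
    have -> : w t = w s * cexp ((t - s) * - l%:C).
      by rewrite /w -mulrA -cexpD; congr (_ * cexp _); ring.
    by rewrite mulrAC si mul1r.
  by rewrite mulrA mulrAC mulfK.
exists (fun t => p.[t] * A t + (t - s) * (rest t + remainder_sum K t)); split.
- apply: holomorphic_atD; first exact: (holomorphic_atM (holomorphic_at_horner p s) hA).
  apply: (holomorphic_atM hts); exact: (holomorphic_atD hrest htail).
- by rewrite subrr mul0r addr0 As pE mulrC.
- have : \forall t \near (s : R[i]^o)^', t != s.
    by apply/dnearE_cmod; exists 1.
  move: near_eq; apply: filterS2 => t -> ts.
  by rewrite mulrDl [(t - s) * _]mulrC mulfK // subr_eq0.
rewrite /local_polar_sum -pE => /eqP p0.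
have /factor_theorem[q pq] : root p s by [].
exists (fun t => q.[t] * A t + (rest t + remainder_sum K t)).
  apply: holomorphic_atD; first exact: (holomorphic_atM (holomorphic_at_horner q s) hA).
  exact: (holomorphic_atD hrest htail).
have : \forall t \near (s : R[i]^o)^', t != s.
  by apply/dnearE_cmod; exists 1.
move: near_eq; apply: filterS2 => t -> ts; congr (_ + _).
by rewrite pq hornerM hornerXsubC mulrAC mulfK // subr_eq0.
Qed.

End Continuation.

(** * The perturbation in a dominated recurrence *)

Section RealEstimates.
Variable R : realType.
Implicit Types (x C r : R).

Lemma ln1D_le x : `|x| <= 2^-1 -> `|ln (1 + x)| <= 2 * `|x|.
Proof.
move=> x2; have /andP[x1 x3] : - 2^-1 <= x <= 2^-1 by rewrite -ler_norml.
have e0 : 0 < 1 + x by lra.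
have up1 : ln (1 + x) <= x.
  by rewrite -[leRHS]expRK ler_ln ?posrE ?expR_gt0 // expR_ge1Dx.
have lo : x / (1 + x) <= ln (1 + x).
  rewrite -[leRHS]opprK -lnV ?posrE // lerNr -[leRHS]expRK ler_ln ?posrE ?expR_gt0 ?invr_gt0 //.
  apply: le_trans (expR_ge1Dx _); rewrite le_eqVlt; apply/orP; left; apply/eqP.
  by field; rewrite gt_eqF.
have lo2 : - (2 * `|x|) <= x / (1 + x).
  rewrite ler_pdivlMr //; have [x0|x0] := leP 0 x.
    by rewrite ger0_norm //; nra.
  by rewrite ltr0_norm //; nra.
rewrite ler_norml (le_trans lo2 lo) /=; apply: le_trans up1 _.
by apply: le_trans (ler_norm x) _; rewrite ler_peMl // ler1n.
Qed.

Lemma geometric_le0 x C r : 0 <= r < 1 -> (forall n, x <= C * r ^+ n) -> x <= 0.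
Proof.
move=> /andP[r0 r1] H; rewrite leNgt; apply/negP => x0.
have : geometric C r @ \oo --> 0 by apply: cvg_geometric; rewrite ger0_norm.
move=> /cvgrPdist_lt/(_ _ x0)[K _ /(_ K (leqnn K))] /=.
by rewrite sub0r normrN => /(le_lt_trans (ler_norm _)); rewrite ltNge H.
Qed.

(** The finitely many exceptions are absorbed by the constant. *)
Lemma geometric_bound_eventually (u : nat -> R) C r N : 0 < r -> 0 <= C ->
  (forall n, (N <= n)%N -> u n <= C * r ^+ n) ->
  exists C', forall n, u n <= C' * r ^+ n.
Proof.
move=> r0 C0 H; exists (C + \sum_(k < N) `|u k| / r ^+ k) => n.
have S0 : 0 <= \sum_(k < N) `|u k| / r ^+ k.
  by apply: sumr_ge0 => k _; rewrite divr_ge0 ?exprn_ge0 // ltW.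
have rn : 0 < r ^+ n by rewrite exprn_gt0.
have [Nn|nN] := leqP N n.
  by apply: le_trans (H _ Nn) _; rewrite ler_pM2r // lerDl.
rewrite -ler_pdivrMr //; apply: le_trans (_ : \sum_(k < N) `|u k| / r ^+ k <= _);
  last by rewrite lerDr.
rewrite (bigD1 (Ordinal nN)) //= -[leLHS]addr0 lerD //.
  by rewrite ler_pM2r ?invr_gt0 // ler_norm.
by apply: sumr_ge0 => k _; rewrite divr_ge0 ?exprn_ge0 // ltW.
Qed.

End RealEstimates.

Section Perturbation.
Variables (R : realType) (d : nat) (a : nat -> int).
Variables (alpha lambda : 'I_d.+1 -> R[i]).
Hypothesis a_pos : forall n, (0 < n)%N -> 0 < a n.
Hypothesis alpha0_real : alpha ord0 = (complex.Re (alpha ord0))%:C.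
Hypothesis alpha0_gt1 : 1 < complex.Re (alpha ord0).
Hypothesis alpha_dom : forall i : 'I_d, cmod (alpha (lift ord0 i)) < complex.Re (alpha ord0).
Hypothesis closed_form : forall n, (0 < n)%N ->
  (a n)%:~R = \sum_(i < d.+1) lambda i * alpha i ^+ n.
Hypothesis lambda0_neq0 : lambda ord0 != 0.

Local Notation A := (complex.Re (alpha ord0)).

Let A_gt0 : 0 < A. Proof. exact: lt_trans alpha0_gt1. Qed.
Let alpha0_neq0 : alpha ord0 != 0.
Proof. by rewrite alpha0_real (fmorph_eq0 (real_complex R)) gt_eqF. Qed.

(** The constant [1 / 2] ensures [rho > 0], also when there is a single root. *)
Lemma contraction_exists : exists2 rho : R, 0 < rho < 1 &
  forall i : 'I_d, cmod (alpha (lift ord0 i) / alpha ord0) <= rho.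
Proof.
pose q (i : 'I_d) := cmod (alpha (lift ord0 i) / alpha ord0).
exists (\big[Num.max/2^-1]_(i < d) q i).
  apply/andP; split; first by apply: lt_le_trans (bigmax_ge_id _ _ _ _); rewrite invr_gt0.
  apply: bigmax_lt => [|i _]; first by lra.
  rewrite /q cmodM cmodV alpha0_real cmod_real gtr0_norm // ltr_pdivrMr // mul1r.
  exact: alpha_dom.
by move=> i; exact: (le_bigmax _ q i).
Qed.

(** [lambda ord0] is the limit of the positive reals [a_n / alpha_1 ^ n], hence real and
nonnegative, and it is not 0.  Therefore [1 + eps_n = a_n / (lambda_1 alpha_1 ^ n)] is a positive
real, and its logarithm is comparable with [eps_n] as soon as [|eps_n| <= 1 / 2]. *)
Lemma perturbation : exists lam rho C : R,
  let eps n := (a n.+1)%:~R / (lam * A ^+ n.+1) - 1 in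
  [/\ 0 < lam, lambda ord0 = lam%:C, 0 < rho < 1,
     forall i : 'I_d, cmod (alpha (lift ord0 i) / alpha ord0) <= rho &
   [/\ forall n, -1 < eps n,
     forall n, `|ln (1 + eps n)| <= C * rho ^+ n &
     forall n, (eps n)%:C = \sum_(i < d) lambda (lift ord0 i) / lambda ord0 *
          (alpha (lift ord0 i) / alpha ord0) ^+ n.+1]].
Proof.
have [rho rho01 rhoP] := contraction_exists.
have /andP[rho0 rho1] := rho01.
pose e n : R[i] := \sum_(i < d) lambda (lift ord0 i) / lambda ord0 *
          (alpha (lift ord0 i) / alpha ord0) ^+ n.+1.
pose C0 := \sum_(i < d) cmod (lambda (lift ord0 i) / lambda ord0).
have C00 : 0 <= C0 by apply: sumr_ge0 => i _; exact: cmod_ge0.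
have eC n : cmod (e n) <= C0 * rho ^+ n.
  apply: le_trans (cmod_sum _ _ _) _; rewrite mulr_suml; apply: ler_sum => i _.
  rewrite cmodM ler_wpM2l ?cmod_ge0 // cmodX exprS -[leRHS]mul1r.
  by apply: ler_pM; rewrite ?exprn_ge0 ?cmod_ge0 // ?lerXn2r ?nnegrE ?cmod_ge0 ?(ltW rho0) //
    (le_trans (rhoP i)) // ltW.
have aE n : (a n.+1)%:~R = lambda ord0 * alpha ord0 ^+ n.+1 * (1 + e n).
  rewrite closed_form // big_ord_recl mulrDr mulr1 /e mulr_sumr; congr (_ + _).
  apply: eq_bigr => i _; rewrite expr_div_n; field.
  by rewrite expf_neq0 // lambda0_neq0.
pose u n : R := (a n.+1)%:~R / A ^+ n.+1.
have u0 n : 0 < u n by rewrite divr_gt0 ?exprn_gt0 // ltr0z a_pos.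
have uE n : (u n)%:C = lambda ord0 * (1 + e n).
  have -> : (u n)%:C = (a n.+1)%:~R / alpha ord0 ^+ n.+1.
    by rewrite /u fmorph_div rmorph_int rmorphXn /= -alpha0_real.
  by rewrite aE mulrAC mulfK // expf_neq0.
have uL n : cmod ((u n)%:C - lambda ord0) <= cmod (lambda ord0) * C0 * rho ^+ n.
  by rewrite uE mulrDr mulr1 addrAC subrr add0r cmodM -mulrA ler_wpM2l ?cmod_ge0.
have rho01' : 0 <= rho < 1 by rewrite ltW.
(* The imaginary part of [u n - lambda ord0] is constant and tends to 0. *)
have im0 : complex.Im (lambda ord0) = 0.
  apply/eqP; rewrite -normr_le0; apply: (geometric_le0 rho01') => n; apply: le_trans (uL n).
  by apply: le_trans (Im_le_cmod _); rewrite ImD ImN /= sub0r normrN.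
have lamE : lambda ord0 = (complex.Re (lambda ord0))%:C by apply: complex_ext.
set lam := complex.Re (lambda ord0) in lamE.
have lam0 : 0 < lam.
  have : lam != 0 by apply: contra lambda0_neq0 => /eqP E; rewrite lamE E.
  rewrite lt_def => -> /=; rewrite -oppr_le0; apply: (geometric_le0 rho01') => n.
  apply: le_trans (uL n); apply: le_trans (Re_le_cmod _); rewrite ReD ReN /= -/lam.
  by apply: le_trans (ler_norm _); rewrite lerDr ltW.
pose eps n := (a n.+1)%:~R / (lam * A ^+ n.+1) - 1.
have epsE n : (eps n)%:C = e n.
  have l0 : lambda ord0 != 0 := lambda0_neq0.
  have -> : (eps n)%:C = (u n)%:C / lambda ord0 - 1.
    by rewrite lamE -fmorph_div -(rmorph1 (real_complex R)) -rmorphB /eps /u invfM mulrA mulrAC.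
  by rewrite uE mulrAC divff // mul1r addrAC subrr add0r.
have eps1 n : -1 < eps n.
  by rewrite ltrBrDr addNr divr_gt0 ?ltr0z ?a_pos // mulr_gt0 // exprn_gt0.
have epsC n : `|eps n| <= C0 * rho ^+ n by rewrite -cmod_real epsE.
have [C HC] : exists C, forall n, `|ln (1 + eps n)| <= C * rho ^+ n.
  have : geometric C0 rho @ \oo --> 0 by apply: cvg_geometric; rewrite ger0_norm // ltW.
  move=> /cvgrPdist_lt/(_ 2^-1)[|N _ HN]; first by rewrite invr_gt0.
  apply: (@geometric_bound_eventually _ _ (2 * C0) rho N) => //; first by rewrite mulr_ge0.
  move=> n Nn; rewrite -mulrA; apply: le_trans (ln1D_le _) _; last by rewrite ler_wpM2l.
  apply: le_trans (epsC n) _; have := HN n Nn; rewrite /= sub0r normrN => /ltW.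
  by apply: le_trans; exact: ler_norm.
by exists lam, rho, C; split.
Qed.

End Perturbation.

(** * Poles and removable singularities *)

Section Poles.
Variable R : realType.
Implicit Types (s t : R[i]) (f g G H : R[i]^o -> R[i]^o).

Lemma near_dnear s (P : set R[i]^o) : (\forall t \near (s : R[i]^o), P t) ->
  \forall t \near (s : R[i]^o)^', P t.
Proof. by move=> /nearE_cmod[e e0 H]; apply/dnearE_cmod; exists e => // t /H. Qed.

Lemma dnear_near_dnear s (P : set R[i]^o) : (\forall t \near (s : R[i]^o)^', P t) ->
  \forall t \near (s : R[i]^o)^', \forall t' \near (t : R[i]^o), P t'.
Proof.
move=> /dnearE_cmod[e e0 H]; apply/dnearE_cmod; exists e => // t ts tns.
apply/nearE_cmod; have t0 : 0 < cmod (t - s) by rewrite cmod_gt0 subr_eq0.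
exists (Num.min (e - cmod (t - s)) (cmod (t - s))); first by rewrite lt_min subr_gt0 ts.
move=> t'; rewrite lt_min => /andP[h1 h2]; apply: H.
  rewrite -(subrK t t') -addrA; apply: le_lt_trans (cmodD _ _) _.
  by rewrite -ltrBrDr.
by apply: contraTneq h2 => ->; rewrite -leNgt cmodC.
Qed.

Lemma dnear_neq s : \forall t \near (s : R[i]^o)^', t != s.
Proof. by apply/dnearE_cmod; exists 1. Qed.

Lemma lim_dnbhs_continuous f H s : {for (s : R[i]^o), continuous H} ->
  (\forall t \near (s : R[i]^o)^', f t = H t) -> lim (f t @[t --> (s : R[i]^o)^']) = H s.
Proof.
move=> cH fH; apply: cvg_lim; first exact: norm_hausdorff.
move/cvg_cmod: cH => cH; apply/cvg_cmod => e e0.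
by move: (near_dnear (cH _ e0)) fH; apply: filterS2 => t h ->.
Qed.

(** Replaces each value of [f] by the limit of [f] at that point: where [f] agrees with a
holomorphic function off the point, this removes the singularity. *)
Definition fill_in f : R[i]^o -> R[i]^o := fun s => lim (f t @[t --> (s : R[i]^o)^']).

Lemma fill_inE f H s : holomorphic_at H s -> (\forall t \near (s : R[i]^o)^', f t = H t) ->
  fill_in f s = H s.
Proof. by move=> /holomorphic_continuous hH fH; exact: lim_dnbhs_continuous. Qed.

Lemma fill_in_near f H s : (\forall t \near (s : R[i]^o)^', holomorphic_at H t) ->
  (\forall t \near (s : R[i]^o)^', f t = H t) ->
    \forall t \near (s : R[i]^o)^', fill_in f t = H t.
Proof.
move=> hH /dnear_near_dnear; move: hH; apply: filterS2 => t hH fH.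
by apply: fill_inE => //; exact: near_dnear.
Qed.

Lemma fill_in_holomorphic f H s : holomorphic_at H s ->
  (\forall t \near (s : R[i]^o)^', f t = H t) -> holomorphic_at (fill_in f) s.
Proof.
move=> hH fH; apply: eq_holomorphic_at (hH).
have := fill_in_near (near_dnear (holomorphic_at_near hH)) fH.
move=> /dnearE_cmod[e e0 He]; apply/nearE_cmod; exists e => // t ts.
have [->|tns] := eqVneq t s; first by rewrite (fill_inE hH fH).
by rewrite He.
Qed.

Lemma cvg_dnbhs_eq f g s : {for (s : R[i]^o), continuous f} -> {for (s : R[i]^o), continuous g} ->
  (\forall t \near (s : R[i]^o)^', f t = g t) -> f s = g s.
Proof.
move=> cf cg fg; rewrite -(lim_dnbhs_continuous cg fg).
by rewrite (lim_dnbhs_continuous cf) //; apply: near_dnear; apply/nearE_cmod; exists 1.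
Qed.

(** If also [f t = g t / (t - s) ^ m], then [g t = G t * (t - s) ^ (m - 1)] off [s], hence at [s]
by continuity; for [m > 1] this forces [g s = 0]. *)
Lemma pole_of_order_simple f G s m : holomorphic_at G s ->
  (\forall t \near (s : R[i]^o)^', f t = G t / (t - s)) ->
  pole_of_order f s m -> m = 1%N /\ G s != 0.
Proof.
move=> hG fG [m0 [g [hg gs fg]]].
have hts : holomorphic_at (fun t : R[i]^o => t - s : R[i]^o) s.
  exact: (holomorphic_atB (holomorphic_at_id s) (holomorphic_at_cst s s)).
have hX k : holomorphic_at (fun t : R[i]^o => (t - s) ^+ k : R[i]^o) s.
  elim: k => [|k IH]; first exact: holomorphic_at_cst.
  rewrite (_ : (fun t => _) = fun t => (t - s) * (t - s) ^+ k).
    exact: (holomorphic_atM hts IH).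
  by apply/funext => t; rewrite exprS.
have gE : g s = G s * (s - s) ^+ m.-1.
  apply: (@cvg_dnbhs_eq g (fun t => G t * (t - s) ^+ m.-1)).
  - exact: holomorphic_continuous.
  - exact: (holomorphic_continuous (holomorphic_atM hG (hX m.-1))).
  move: fG fg (dnear_neq s); apply: filterS3 => t -> E ts.
  have ts0 : t - s != 0 by rewrite subr_eq0.
  have : G t / (t - s) * (t - s) ^+ m = g t by rewrite E divfK // expf_neq0.
  by move=> <-; rewrite -{1}(prednK m0) exprS mulrA divfK.
case: m m0 fg gE gs => [//|[|m]] _ _ /= ->; rewrite subrr.
  by rewrite expr0 mulr1.
by rewrite expr0n mulr0 eqxx.
Qed.

End Poles.

Section ChainRatio.
Variables (R : realType) (d : nat) (alpha lambda : 'I_d.+1 -> R[i]).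

Let x (i : 'I_d) := alpha (lift ord0 i) / alpha ord0.
Let y (i : 'I_d) := lambda (lift ord0 i) / lambda ord0.

Lemma ratio_chain_exp (k : d.-tuple nat) : sorted geq k -> ratio alpha k = chain_exp x k.
Proof.
move=> sk; rewrite /ratio /chain_exp /root_prod -(sum_chain_steps sk).
rewrite (big_morph (fun n => alpha ord0 ^- n) (id1 := 1) (op1 := *%R)); first last.
- by rewrite expr0 invr1.
- by move=> m n; rewrite exprD invfM.
by rewrite -big_split; apply: eq_bigr => i _; rewrite /x expr_div_n mulrC.
Qed.

(** [ratio alpha k] is a product of [K] factors of modulus at most [rho]. *)
Lemma cmod_ratio_le (rho : R) K (k : d.-tuple nat) :
  (forall i, cmod (x i) <= rho) -> k \in chains d K -> cmod (ratio alpha k) <= rho ^+ K.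
Proof.
move=> xr; rewrite mem_chains => /andP[sk /eqP <-].
rewrite ratio_chain_exp // -(sum_chain_steps sk) /chain_exp cmod_prod.
rewrite -prodrXr ler_prod // => i _; rewrite cmodX exprn_ge0 ?cmod_ge0 //=.
by rewrite lerXn2r ?nnegrE ?cmod_ge0 // (le_trans (cmod_ge0 _) (xr i)).
Qed.

(** The coefficient of [ratio alpha k ^ n] in the expansion of the power of [eps_n] of order
[k_1]. *)
Definition chain_coef (k : d.-tuple nat) : R[i] := chain_binom _ k * chain_exp y k.

Lemma multinomial_power K n :
  (\sum_(i < d) y i * x i ^+ n) ^+ K = \sum_(k <- chains d K) chain_coef k * ratio alpha k ^+ n.
Proof.
rewrite multinomial big_seq [RHS]big_seq; apply: eq_bigr => k.
rewrite mem_chains => /andP[sk _]; rewrite /chain_coef -mulrA; congr (_ * _).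
rewrite ratio_chain_exp // /chain_exp -prodrXl -big_split; apply: eq_bigr => i _ /=.
by rewrite exprMn exprAC.
Qed.

End ChainRatio.

(** * The Lerch series *)

Section Lerch.
Variables (R : realType) (d : nat) (a : nat -> int) (z : R[i]).
Variables (alpha lambda : 'I_d.+1 -> R[i]) (lam rho C : R).
Local Notation A := (complex.Re (alpha ord0)).
Local Notation l := (log_dominant alpha).
Let eps n : R := (a n.+1)%:~R / (lam * A ^+ n.+1) - 1.
Let w (t : R[i]) : R[i] := z * cexp (- t * l%:C).

Hypothesis alpha_neq0 : forall i, alpha i != 0.
Hypothesis alpha0_real : alpha ord0 = A%:C.
Hypothesis alpha0_gt1 : 1 < A.
Hypothesis z_neq0 : z != 0.
Hypothesis lam_gt0 : 0 < lam.
Hypothesis rho01 : 0 < rho < 1.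
Hypothesis rhoP : forall i : 'I_d, cmod (alpha (lift ord0 i) / alpha ord0) <= rho.
Hypothesis eps_gtN1 : forall n, -1 < eps n.
Hypothesis ln_eps : forall n, `|ln (1 + eps n)| <= C * rho ^+ n.
Hypothesis epsE : forall n, (eps n)%:C = \sum_(i < d) lambda (lift ord0 i) / lambda ord0 *
          (alpha (lift ord0 i) / alpha ord0) ^+ n.+1.

Let deg (k : d.-tuple nat) := kidx k 0.

Let l_gt0 : 0 < l. Proof. exact: log_dominant_gt0. Qed.

Let deg_idx k i : i \in chains d k -> deg i = k.
Proof. by rewrite mem_chains => /andP[_ /eqP]. Qed.

Let beta_le k i : i \in chains d k -> cmod (ratio alpha i) <= rho ^+ k.
Proof. exact: cmod_ratio_le. Qed.

Let epsX k n : (eps n)%:C ^+ k =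
  \sum_(i <- chains d k) chain_coef lambda i * ratio alpha i ^+ n.+1.
Proof. by rewrite epsE multinomial_power. Qed.

Let Phi : R[i] -> R[i] :=
  continuation l rho z eps (chains d) (chain_coef lambda) (ratio alpha) deg.
Let scale (t : R[i]) : R[i] := cexp (t * - (ln lam)%:C).
Let raw_continuation (t : R[i]^o) : R[i]^o := scale t * Phi t.

Lemma lerch_term_factor s n :
  lerch_term a z s n.+1 = scale s * (w s ^+ n.+1 * cexp (- s * (ln (1 + eps n))%:C)).
Proof.
have A0 : 0 < A by rewrite (lt_trans ltr01).
have aE : (a n.+1)%:~R = lam * (A ^+ n.+1 * (1 + eps n)).
  rewrite mulrA /eps addrCA subrr addr0 mulrC divfK // gt_eqF // mulr_gt0 // exprn_gt0 //.
have e0 : 0 < 1 + eps n by rewrite -(ltrD2l (-1)) addrA addNr add0r addr0.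
have lnE : ln ((a n.+1)%:~R : R) = ln lam + (n.+1%:R * l + ln (1 + eps n)).
  rewrite aE lnM ?posrE ?mulr_gt0 ?exprn_gt0 //; congr (_ + _).
  by rewrite lnM ?posrE ?exprn_gt0 // lnXn // mulr_natl.
rewrite /lerch_term lnE /scale /w exprMn -cexpM_nat.
rewrite -(mulrA (z ^+ n.+1)) -cexpD [RHS]mulrCA -cexpD; congr (_ * cexp _).
by rewrite !rmorphD rmorphM rmorph_nat /=; ring.
Qed.

Lemma abscissa_w s : abscissa alpha z < complex.Re s -> cmod (w s) < 1.
Proof.
rewrite /abscissa ltr_pdivrMr // => H.
rewrite /w cmodM cmod_cexp ReM_real ReN mulNr.
have z0 : 0 < cmod z by rewrite cmod_gt0.
rewrite -{1}(lnK (x := cmod z)) ?posrE // -expRD -expR0 ltr_expR subr_lt0 //.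
Qed.

Lemma lerch_cvg s : abscissa alpha z < complex.Re s ->
  lerch_partial_sum a z s @ \oo --> (raw_continuation s : R[i]^o).
Proof.
move=> /abscissa_w ws; rewrite -cvg_shiftS.
rewrite (_ : (fun n => _) =
  series ((fun n => scale s * (w s ^+ n.+1 * cexp (- s * (ln (1 + eps n))%:C))) : nat -> R[i]^o)).
  apply: csumZ.
  exact: (continuation_series l_gt0 rho01 eps_gtN1 ln_eps deg_idx beta_le epsX ws).
apply/funext => n; rewrite /lerch_partial_sum big_add1 /= /series /=.
by apply: eq_bigr => k _; rewrite lerch_term_factor.
Qed.

Lemma lerch_seriesE s : abscissa alpha z < complex.Re s ->
  lerch_series a z s = raw_continuation s.
Proof. by move=> /lerch_cvg H; apply: cvg_lim H; exact: norm_hausdorff. Qed.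

Lemma holomorphic_at_raw_continuation s : abscissa alpha z < complex.Re s ->
  holomorphic_at raw_continuation s.
Proof.
move=> /abscissa_w ws; apply: holomorphic_atM; first exact: holomorphic_at_cexp.
exact: (continuation_holomorphic l_gt0 rho01 eps_gtN1 ln_eps deg_idx beta_le epsX).
Qed.

Lemma lerch_holomorphic s : abscissa alpha z < complex.Re s ->
  holomorphic_at (lerch_series a z) s.
Proof.
move=> sa; apply: eq_holomorphic_at (holomorphic_at_raw_continuation sa).
have e0 : 0 < complex.Re s - abscissa alpha z by rewrite subr_gt0.
apply/nearE_cmod; exists (complex.Re s - abscissa alpha z) => // t ts.
rewrite lerch_seriesE //; have := le_lt_trans (Re_le_cmod _) ts.
by rewrite ReD ReN ltr_norml => /andP[+ _]; lra.
Qed.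

Lemma mem_below_chains K k : (k \in below (chains d) K) = sorted geq k && (deg k < K)%N.
Proof.
elim: K => [|K IH]; first by rewrite /below big_ord0 in_nil andbF.
by rewrite below_recr mem_cat IH mem_chains -andb_orr ltnS [in RHS]leq_eqVlt orbC.
Qed.

Lemma uniq_below_chains K : uniq (below (chains d) K).
Proof.
elim: K => [|K IH]; first by rewrite /below big_ord0.
rewrite below_recr cat_uniq IH uniq_chains andbT /=; apply/hasPn => k.
by rewrite mem_below_chains mem_chains => /andP[_ /eqP E]; rewrite /deg E ltnn andbF.
Qed.

(** A tuple that contributes at [s] satisfies [|ratio k| = 1 / |w s| > rho ^ K], so that its first
entry is less than [K] ([cmod_ratio_le]).  In particular only finitely many tuples contribute, and
the two sums range over the same set. *)
Lemma local_polar_sumE K s : half_plane l rho z K s ->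
  local_polar_sum l z (chains d) (chain_coef lambda) (ratio alpha) deg K s =
    polar_coef alpha lambda z s.
Proof.
move=> dK; rewrite /local_polar_sum /polar_coef -big_filter.
have -> : indices_at alpha z s =
  [set` [seq k <- below (chains d) K | z * cexp (- s * l%:C) * ratio alpha k == 1]].
  apply/seteqP; split => k /=.
    move=> [sk /(lerch_pointP alpha_neq0 alpha0_real alpha0_gt1 z_neq0) E].
    rewrite mem_filter E eqxx mem_below_chains sk /= ltnNge; apply/negP => Kk.
    move: (dK); rewrite /half_plane ltNge => /negP; apply.
    rewrite -(@cmod1 R) -E cmodM ler_wpM2l ?cmod_ge0 //.
    apply: le_trans (@beta_le (deg k) k _) _; first by rewrite mem_chains sk /=.
    by case/andP: rho01 => r0 r1; rewrite ler_wiXn2l // ltW.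
  rewrite mem_filter mem_below_chains => /andP[/eqP E /andP[sk _]]; split => //.
  exact/(lerch_pointP alpha_neq0 alpha0_real alpha0_gt1 z_neq0).
rewrite -fsbig_seq ?filter_uniq ?uniq_below_chains //.
by apply: eq_bigr => k _; rewrite /chain_coef /chain_binom /chain_exp mulrA.
Qed.

Definition lerch_continuation : R[i]^o -> R[i]^o := fill_in raw_continuation.

Lemma lerch_continuationE s : abscissa alpha z < complex.Re s ->
  lerch_continuation s = lerch_series a z s.
Proof.
move=> sa; rewrite lerch_seriesE //; apply: fill_inE;
  first exact: holomorphic_at_raw_continuation.
by apply: near_dnear; apply/nearE_cmod; exists 1.
Qed.

(** The factor [scale] has no zeros, so it affects neither the order of the singularity nor the
vanishing of its coefficient. *)
Lemma lerch_continuation_local s : exists G : R[i]^o -> R[i]^o,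
  [/\ holomorphic_at G s, (G s == 0) = (polar_coef alpha lambda z s == 0),
      \forall t \near (s : R[i]^o)^', lerch_continuation t = G t / (t - s) &
      polar_coef alpha lambda z s = 0 -> holomorphic_at lerch_continuation s].
Proof.
have [K dK] := half_plane_exists l z rho01 s.
have [G [hG Gs nG H]] := continuation_local l_gt0 rho01 eps_gtN1 ln_eps deg_idx beta_le epsX dK.
rewrite (local_polar_sumE dK) in Gs H.
have hs t : holomorphic_at (scale : R[i]^o -> R[i]^o) t by exact: holomorphic_at_cexp.
have hsG := holomorphic_atM (hs s) hG.
exists (fun t => scale t * G t); split.
- exact: hsG.
- rewrite mulf_eq0 (negPf (cexp_neq0 _)) Gs mulf_eq0 invr_eq0.
  by rewrite (fmorph_eq0 (real_complex R)) gt_eqF.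
- apply: fill_in_near.
    move: (near_dnear (holomorphic_at_near hsG)) (dnear_neq s); apply: filterS2 => t ht ts.
    apply: (holomorphic_atM ht); apply: holomorphic_atV; last by rewrite subr_eq0.
    exact: (holomorphic_atB (holomorphic_at_id t) (holomorphic_at_cst s t)).
  by move: nG; apply: filterS => t E; rewrite /raw_continuation /Phi E mulrA.
- move=> /H[H0 hH0 nH]; apply: (fill_in_holomorphic (holomorphic_atM (hs s) hH0)).
  by move: nH; apply: filterS => t E; rewrite /raw_continuation /Phi E.
Qed.

Lemma is_pole_lerch s : is_pole lerch_continuation s <-> polar_coef alpha lambda z s != 0.
Proof.
have [G [hG Gs nG _]] := lerch_continuation_local s; rewrite -Gs; split.
  by move=> [m /(pole_of_order_simple hG nG)[]].
by move=> G0; exists 1%N; split=> //; exists G; split => //; move: nG; apply: filterS => t ->;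
  rewrite expr1.
Qed.

Lemma lerch_pole_simple s m : pole_of_order lerch_continuation s m -> m = 1%N.
Proof.
have [G [hG Gs nG _]] := lerch_continuation_local s.
by move=> /(pole_of_order_simple hG nG)[].
Qed.

Lemma lerch_meromorphic : meromorphic lerch_continuation.
Proof.
move=> s; have [G [_ _ _ H]] := lerch_continuation_local s.
have [/eqP/H|p0] := boolP (polar_coef alpha lambda z s == 0); first by left.
by right; apply/is_pole_lerch.
Qed.

Lemma polar_coef_indices s : polar_coef alpha lambda z s != 0 ->
  exists (n : int) (k : d.-tuple nat), sorted geq k /\ s = lerch_point alpha z n k.
Proof.
move=> p0; have [k [sk [n sE]]] : indices_at alpha z s !=set0.
  by apply/set0P; apply: contra p0 => /eqP E; rewrite /polar_coef E fsbig_set0.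
by exists n, k.
Qed.

End Lerch.

Theorem theorem4p1 (R : realType) (d : nat) (a : nat -> int)
    (P : {poly int}) (alpha : 'I_d.+1 -> R[i]) (z : R[i])
    (a_pos : forall n : nat, (0 < n)%N -> 0 < a n)
    (a_incr : forall n : nat, (0 < n)%N -> a n < a n.+1)
    (P_min : minimal_annihilator P a)
    (P_irr : irreducible_poly (map_poly intr P : {poly rat}))
    (P_roots : map_poly intr P = \prod_(i < d.+1) ('X - (alpha i)%:P))
    (alpha1_real : alpha ord0 \is Num.real)
    (alpha1_gt1 : 1 < alpha ord0)
    (alpha1_dom : forall i : 'I_d.+1, i != ord0 -> `|alpha i| < alpha ord0)
    (z_neq0 : z != 0) :
  (forall s : R[i], abscissa alpha z < complex.Re s ->
     cvgn (lerch_partial_sum a z s) /\ holomorphic_at (lerch_series a z) s) /\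
  exists (lambda : 'I_d.+1 -> R[i]) (F : R[i]^o -> R[i]^o),
    (forall n : nat, (0 < n)%N ->
       (a n)%:~R = \sum_(i < d.+1) lambda i * alpha i ^+ n) /\
    meromorphic F /\
    (forall s : R[i], abscissa alpha z < complex.Re s ->
       F s = lerch_series a z s) /\
    (forall (s : R[i]) (m : nat), pole_of_order F s m -> m = 1%N) /\
    (forall s : R[i], is_pole F s ->
       exists (n : int) (k : d.-tuple nat),
         sorted geq k /\ s = lerch_point alpha z n k) /\
    (forall (n : int) (k : d.-tuple nat), sorted geq k ->
       (is_pole F (lerch_point alpha z n k) <->
        polar_coef alpha lambda z (lerch_point alpha z n k) != 0)).
Proof.
have [P_monic P_ann _] := P_min.
have al0 : alpha ord0 != 0 by rewrite gt_eqF // (lt_trans ltr01).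
have alpha0E : alpha ord0 = (complex.Re (alpha ord0))%:C by rewrite RRe_real.
have A1 : 1 < complex.Re (alpha ord0) by rewrite -ltcR -alpha0E.
have dom0 (i : 'I_d) : cmod (alpha (lift ord0 i)) < complex.Re (alpha ord0).
  by rewrite -ltcR -norm_cmod -alpha0E alpha1_dom.
have alN i : alpha i != 0 := alpha_neq0 P_irr P_roots i al0.
have a1 : a 1%N != 0 by rewrite gt_eqF // a_pos.
have [lambda [lam0 cf]] := closed_form P_monic P_ann P_irr P_roots al0 a1.
have [lam [rho [C [lam_gt0 _ rho01 rhoP [e1 e2 e3]]]]] :=
  perturbation a_pos alpha0E A1 dom0 cf lam0.
split=> [s sa|].
  split; last exact: (lerch_holomorphic A1 z_neq0 lam_gt0 rho01 rhoP e1 e2 e3 sa).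
  by apply: cvgP (lerch_cvg A1 z_neq0 lam_gt0 rho01 rhoP e1 e2 e3 sa).
have poles := is_pole_lerch alN alpha0E A1 z_neq0 rho01 rhoP e1 e2 e3.
exists lambda, (lerch_continuation a z alpha lambda lam rho).
split; [exact: cf|split; [|split; [|split; [|split]]]].
- exact: (lerch_meromorphic alN alpha0E A1 z_neq0 rho01 rhoP e1 e2 e3).
- by move=> s sa; exact: (lerch_continuationE A1 z_neq0 lam_gt0 rho01 rhoP e1 e2 e3 sa).
- exact: (lerch_pole_simple alN alpha0E A1 z_neq0 rho01 rhoP e1 e2 e3).
- by move=> s /poles/polar_coef_indices.
- by move=> n k _; exact: poles.
Qed.
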